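(* Let $X_1,\dots,X_n\in\mathbb{R}^p$ and $Y_1,\dots,Y_n\in\mathbb{R}^p$ be random vectors satisfying the standing assumptions listed in the context, let $D$ be a deterministic $n\times n$ diagonal matrix with positive diagonal entries $R_1,\dots,R_n$, let $A$ be a deterministic positive definite $p\times p$ matrix with $A\succeq t\,\mathrm{Id}_p$ for some $t>0$, and let $\Sigma_\varepsilon$ be a deterministic positive semidefinite $p\times p$ matrix. For deterministic $x\in\mathbb{R}^p$ and $\alpha\in\mathbb{R}^n$ with $\|\alpha\|=1$ let, with $M=X^\top D^2X/n+A$, $$H(\alpha;X)=\frac1{\sqrt n}\alpha^\top DX\,M^{-1}\Sigma_\varepsilon M^{-1}x ,$$ define $H(\alpha;Y)$ in the same way with $Y$ in place of $X$, and let $b(A;\Sigma_\varepsilon)=\|A^{-1/2}\Sigma_\varepsilon A^{-1/2}\|_{op}$. Then, for a constant $K$, $\mathrm{var}(H(\alpha;X))\le\sum_{i=1}^nV_i$ with $$V_i\le K\,b^2(A;\Sigma_\varepsilon)\frac{x^\top A^{-1}x}{t}\left[\frac{R_i^2}{n}\alpha_i^2b_L(2;X_i)+\frac{R_i^4}{n^2}b_L(4;X_i)\frac1t\right],$$ and $$\left|\mathbb{E}[H(\alpha;X)-H(\alpha;Y)]\right|\le\sum_{i=1}^n\big(U_i(X_i)+U_i(Y_i)\big),$$ where $$U_i(X_i)\le K\,b(A;\Sigma_\varepsilon)\sqrt{\frac{x^\top A^{-1}x}{t}}\left[\frac1{\sqrt n}|\alpha_i|R_i\sqrt{b_L(2;X_i)}+\frac{R_i^2}{n}\sqrt{\frac{b_L(4;X_i)}{t}}\right]\left[\frac{R_i^2}{n}\frac{\sqrt{b_{Q_2}(2;X_i)}}{t}\wedge1\right],$$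 and $U_i(Y_i)$ satisfies the same bound with $Y_i$ in place of $X_i$.
   Context: Notation: $X$ (resp. $Y$) is the $n\times p$ matrix whose $i$-th row is $X_i^\top$ (resp. $Y_i^\top$). $a\wedge b=\min(a,b)$; $\succeq$ is the Loewner order; $\|\cdot\|_{op}$ is the operator norm; $\|\alpha\|$ is the Euclidean norm. $K$ is a numerical constant. Standing assumptions: the ratio $p/n$ stays bounded away from $0$ and $\infty$; the $X_j$ are independent, the $Y_j$ are independent, and the $Y_j$'s are independent of the $X_j$'s; for each $j$, $X_j$ and $Y_j$ have mean $0$ and the same covariance matrix $\Sigma_j$. For $Z\in\{X_j,Y_j\}$ and $k\ge1$, $b_L(k;Z)$ and $b_{Q_2}(k;Z)$ are deterministic numbers (finite for the exponents that appear) such that $\mathbb{E}|Z^\top v|^k\le b_L(k;Z)$ for every deterministic unit vector $v$, and $\mathbb{E}|Z^\top MZ-\mathbb{E}[Z^\top MZ]|^k\le b_{Q_2}(k;Z)$ for every deterministic positive semidefinite $M$ with $\|M\|_{op}\le1$. Without loss of generality $b_L(k;Z)\le\sqrt{b_L(2k;Z)}$. *)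

(* Defs.v *)
From HB Require Import structures.
From mathcomp Require Import all_boot all_order all_algebra.
From mathcomp Require Import all_classical all_reals all_analysis.

Set Implicit Arguments.
Unset Strict Implicit.
Unset Printing Implicit Defensive.

Import Order.TTheory GRing.Theory Num.Theory.
Import numFieldNormedType.Exports.

Local Open Scope classical_set_scope.
Local Open Scope ring_scope.

Section LinearAlgebra.
Context {R : realType}.

Definition dotv (p : nat) (u v : 'cV[R]_p) : R := (u^T *m v) 0 0.

(* The library's norm on matrices is the sup norm, hence a separate Euclidean
   norm. *)
Definition enorm (p : nat) (u : 'cV[R]_p) : R := Num.sqrt (dotv u u).

Definition qform (p : nat) (M : 'M[R]_p) (u : 'cV[R]_p) : R :=
  (u^T *m M *m u) 0 0.

Definition opnorm (m p : nat) (M : 'M[R]_(m, p)) : R :=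
  sup [set enorm (M *m u) | u in [set u : 'cV[R]_p | enorm u <= 1]].

Definition psdmx (p : nat) (M : 'M[R]_p) : Prop :=
  M^T = M /\ forall u : 'cV[R]_p, 0 <= qform M u.

Definition pdmx (p : nat) (M : 'M[R]_p) : Prop :=
  M^T = M /\ forall u : 'cV[R]_p, u != 0 -> 0 < qform M u.

Definition loewner_ge (p : nat) (M N : 'M[R]_p) : Prop := psdmx (M - N).

(* The positive semidefinite square root. It exists and is unique when A is
   positive semidefinite; the default value 0 is only reached for other A. *)
Definition sqrtmx (p : nat) (A : 'M[R]_p) : 'M[R]_p :=
  xget 0 [set B : 'M[R]_p | psdmx B /\ B *m B = A].

Definition b_op (p : nat) (A Seps : 'M[R]_p) : R :=
  opnorm (invmx (sqrtmx A) *m Seps *m invmx (sqrtmx A)).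

Definition Hstat (n p : nat) (r : 'I_n -> R) (A Seps : 'M[R]_p)
    (x : 'cV[R]_p) (alpha : 'cV[R]_n) (X : 'M[R]_(n, p)) : R :=
  let D := diag_mx (\row_i r i) in
  let M := n%:R^-1 *: (X^T *m (D *m D) *m X) + A in
  (Num.sqrt n%:R)^-1 *
  (alpha^T *m D *m X *m invmx M *m Seps *m invmx M *m x) 0 0.

End LinearAlgebra.

Section Probability.
Context {d : measure_display} {T : measurableType d} {R : realType}.
Variable P : probability T R.

Definition rvec (p : nat) (Z : 'I_p -> {RV P >-> R}) (w : T) : 'cV[R]_p :=
  \col_j Z j w.

Definition rmx (n p : nat) (X : 'I_n -> 'I_p -> {RV P >-> R}) (w : T) :
  'M[R]_(n, p) := \matrix_(i, j) X i j w.

Definition sigma_vec (p : nat) (Z : 'I_p -> {RV P >-> R}) : set (set T) :=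
  g_sigma_preimage (fun j => Z j : T -> R).

Definition sigma_family (n p : nat) (X : 'I_n -> 'I_p -> {RV P >-> R}) :
  set (set T) := <<s \bigcup_(i in [set: 'I_n]) sigma_vec (X i) >>.

Definition mutually_independent (n p : nat)
    (X : 'I_n -> 'I_p -> {RV P >-> R}) : Prop :=
  forall (J : {set 'I_n}) (E : 'I_n -> set T),
    (forall i, i \in J -> sigma_vec (X i) (E i)) ->
    (P (\bigcap_(i in [set` J]) E i) = \prod_(i in J) P (E i))%E.

Definition independent_families (n p : nat)
    (X Y : 'I_n -> 'I_p -> {RV P >-> R}) : Prop :=
  forall E F : set T, sigma_family X E -> sigma_family Y F ->
    (P (E `&` F) = P E * P F)%E.

Definition linear_moment_bound (p : nat) (Z : 'I_p -> {RV P >-> R})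
    (k : nat) (b : \bar R) : Prop :=
  forall v : 'cV[R]_p, enorm v = 1 ->
    ('E_P[fun w => (`|dotv (rvec Z w) v| ^+ k)%R] <= b)%E.

Definition quadratic_moment_bound (p : nat) (Z : 'I_p -> {RV P >-> R})
    (k : nat) (b : \bar R) : Prop :=
  forall M : 'M[R]_p, psdmx M -> opnorm M <= 1 ->
    ('E_P[fun w => (`|qform M (rvec Z w)
        - fine 'E_P[fun w' => qform M (rvec Z w')]%E| ^+ k)%R]
     <= b)%E.

(* [bL k] and [bQ2 k] may be +oo, except for the exponents 2 and 4 of [bL] and
   2 of [bQ2], the only ones used in the bounds. *)
Definition moment_numbers (p : nat) (Z : 'I_p -> {RV P >-> R})
    (bL bQ2 : nat -> \bar R) : Prop :=
  [/\ forall k, (1 <= k)%N -> linear_moment_bound Z k (bL k),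
      forall k, (1 <= k)%N -> quadratic_moment_bound Z k (bQ2 k),
      forall k, (1 <= k)%N -> (bL k <= sqrte (bL (2 * k)%N))%E &
      [/\ bL 2%N \is a fin_num, bL 4%N \is a fin_num
        & bQ2 2%N \is a fin_num]].

Definition centered_with_cov (p : nat) (Z : 'I_p -> {RV P >-> R})
    (Sigma : 'M[R]_p) : Prop :=
  (forall j, ('E_P[Z j] = 0)%E) /\
  (forall j k, covariance P (Z j) (Z k) = (Sigma j k)%:E).

End Probability.

(* Main.v *)
Require Import Defs.
From HB Require Import structures.
From mathcomp Require Import all_boot all_order all_algebra.
From mathcomp Require Import all_classical all_reals all_analysis.
From mathcomp Require Import measurable_realfun.
From mathcomp Require Import ring lra.
From mathcomp Require complex.
Import Order.TTheory GRing.Theory Num.Theory.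
Import numFieldNormedType.Exports.
Local Open Scope classical_set_scope.
Local Open Scope ring_scope.

(** Write [S] for the matrix [Seps], [rho i] for [r i ^+ 2 / n], and [w] for the
vector X^T D alpha / sqrt n. The statistic is H = w^T M^-1 S M^-1 x, and row
[i] of the data enters only through one term of w and one rank-one term
[rho i] X_i X_i^T of M = A + sum_i [rho i] X_i X_i^T. Both assertions follow
from a description of the increment of H when row [i] is inserted.

Let G be the inverse of M without row [i], and z the row inserted. By the
Sherman-Morrison formula ([rank_one_update]) the increment is
c P(z) + c^2 h Q(z), where P and Q are polynomials of degree two in linear
forms of z, c = 1 / (1 + s), s = [rho i] z^T G z and h = [rho i] z^T G S G z.
The vectors of these linear forms have norms that are controlled by
A <= M, t Id <= M and S <= b A, together with the bound w^T M^-1 w <= 1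
([qform_inv_score]), which holds because M contains the rows that make up w.
Moreover 0 <= c <= 1 and 0 <= c^2 h <= b, so the fluctuations of s and h are
damped. The moments of order 2 and 4 of linear forms then bound the second
moment of the increment ([increment_moment2]).

Variance: the Efron-Stein inequality ([efron_stein]) bounds the variance of H
by the sum over [i] of the second moments of these increments.

Mean: the rows of X are exchanged for those of Y one at a time, along families
that are still mutually independent ([hybrid_independent]). At each step the
increments of the old and of the new row over the same remaining data are
compared. If s and h are replaced by their expectations, which depend on z
only through its covariance, the expectation of the increment is the same for
both rows. The error is the expectation of P times the fluctuation of c and of
Q times that of c^2 h; Cauchy-Schwarz and the moments of order 2 of quadratic
forms bound it ([increment_mean]).

In both parts independence is used through one statement ([decouple]): the
expectation of a bounded function of the data is unchanged if some of the rows
are replaced by an independent copy of them. Since H is bounded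
([Hstat_bounded]), this applies to H, to its increments and to their
squares. *)

Set Implicit Arguments.
Unset Strict Implicit.
Unset Printing Implicit Defensive.

(** * Square roots of positive semidefinite matrices *)

Lemma interpolation (F : fieldType) (f : F -> F) (s : seq F) :
  exists r : {poly F}, forall x, x \in s -> r.[x] = f x.
Proof.
elim: s => [|x s [r rP]]; first by exists 0 => ?; rewrite in_nil.
have [xs|xs] := boolP (x \in s).
  by exists r => y; rewrite inE => /predU1P[->|]; exact: rP.
pose w := \prod_(y <- s) ('X - y%:P).
have wx : w.[x] != 0.
  rewrite -rootE; apply: contra xs; rewrite /w root_prod_XsubC //.
exists (r + ((f x - r.[x]) / w.[x]) *: w) => y.
rewrite inE => /predU1P[->|ys]; rewrite hornerD hornerZ.
  by rewrite divfK // addrC subrK.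
have /eqP -> : root w y by rewrite root_prod_XsubC.
by rewrite mulr0 addr0 rP.
Qed.

Lemma qform_sum_sqr (R : realType) (p : nat) (B : 'M[R]_p) (u : 'cV[R]_p) :
  qform (B^T *m B) u = dotv (B *m u) (B *m u).
Proof. by rewrite /qform /dotv trmx_mul !mulmxA. Qed.

Lemma dotvv_ge0 (R : realType) (p : nat) (u : 'cV[R]_p) : 0 <= dotv u u.
Proof. by rewrite /dotv mxE sumr_ge0 // => i _; rewrite mxE -expr2 sqr_ge0. Qed.

Lemma dotvv_gt0 (R : realType) (p : nat) (u : 'cV[R]_p) : u != 0 -> 0 < dotv u u.
Proof.
move=> u0; rewrite lt_neqAle dotvv_ge0 andbT eq_sym; apply: contra u0.
rewrite /dotv mxE psumr_eq0 => [/allP u0|i _]; last by rewrite mxE -expr2 sqr_ge0.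
apply/eqP/matrixP => i j; rewrite ord1 mxE.
by have := u0 i (mem_index_enum _); rewrite mxE -expr2 sqrf_eq0 => /eqP.
Qed.

Section Spectrum.
Import complex.

(** Evaluating a real polynomial at a positive semidefinite matrix only sees its
spectrum. The matrix is diagonalised over the complex numbers; its eigenvalues
are real, and nonnegative because the real or the imaginary part of an
eigenvector is a nonzero real eigenvector. *)
Lemma psd_spectrum (R : realType) (p : nat) (A : 'M[R]_p.+1) : psdmx A ->
  exists2 s : seq R, (forall x, x \in s -> 0 <= x) &
    forall r : {poly R}, (forall x, x \in s -> r.[x] = 0) -> horner_mx A r = 0.
Proof.
move=> [symA psdA].
pose AC : 'M[R[i]]_p.+1 := map_mx (real_complex R) A.
have realAC : AC \is a mxOver Num.real.
  by apply/mxOverP => i j; rewrite mxE complex_real.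
have symAC : AC \is symmetricmx.
  by apply/is_hermitianmxP; rewrite expr0 scale1r map_mx_id // /AC map_trmx symA.
have hermAC := realsym_hermsym symAC realAC.
set U := spectralmx AC; set sp := spectral_diag AC.
have /orthomx_spectralP AE : AC \is normalmx := hermitian_normalmx hermAC.
have Uu : U \in unitmx := spectral_unit _.
have spr j : sp 0 j = (complex.Re (sp 0 j))%:C%C.
  have /mxOverP/(_ 0 j) := hermitian_spectral_diag_real hermAC.
  by move=> /Creal_ImP; case: (sp 0 j) => a b; rewrite -complexIm /= => -[->].
exists [seq complex.Re (sp 0 j) | j <- enum 'I_p.+1].
  move=> x /mapP[j _ ->].
  pose u := row j U.
  have uA : u *m AC = (complex.Re (sp 0 j))%:C%C *: u.
    rewrite -spr /u -row_mul AE !mulmxA mulmxV // mul1mx.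
    by rewrite row_mul row_diag_mx -scalemxAl -rowE.
  have part (g : {additive R[i] -> R}) : (forall x y, g (x%:C%C * y) = x * g y) ->
      let a := map_mx g u in a *m A = complex.Re (sp 0 j) *: a.
    move=> gZ a; apply/matrixP => i k; rewrite !mxE.
    have /matrixP/(_ i k) := uA; rewrite !mxE => /(congr1 g); rewrite gZ => <-.
    rewrite raddf_sum; apply: eq_bigr => l _.
    by rewrite !mxE mulrC -gZ mulrC.
  have nonneg (g : {additive R[i] -> R}) : (forall x y, g (x%:C%C * y) = x * g y) ->
      map_mx g u != 0 -> 0 <= complex.Re (sp 0 j).
    move=> gZ a0; have aA := part g gZ; move: aA a0; set a := map_mx g u => /= aA a0.
    have := psdA a^T; rewrite /qform trmxK aA -scalemxAl mxE pmulr_lge0 //.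
    rewrite -[X in X *m _]trmxK; apply: dotvv_gt0.
    by rewrite -(inj_eq trmx_inj) trmxK trmx0.
  have [Re0|] := eqVneq (map_mx (@complex.Re R) u) 0; last first.
    by apply: (nonneg (@complex.Re R)) => a [? ?] /=; rewrite mul0r subr0.
  have [Im0|] := eqVneq (map_mx (@complex.Im R) u) 0; last first.
    by apply: (nonneg (@complex.Im R)) => a [? ?] /=; rewrite mul0r addr0.
  have : row_free U by rewrite row_free_unit.
  move=> /row_freePn; case; exists j; rewrite (_ : row j U = 0) ?sub0mx //.
  apply/matrixP => i k; apply/eqP; rewrite eq_complex.
  by have /matrixP/(_ i k) := Re0; have /matrixP/(_ i k) := Im0; rewrite !mxE /= => -> ->; rewrite eqxx.
move=> r r0.
apply: (@map_mx_inj _ _ (real_complex R)).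
rewrite map_mx0 map_horner_mx -/AC AE (horner_mx_uconjC _ _ Uu) horner_mx_diag.
rewrite (_ : map_mx _ sp = 0) ?linear0 ?mulmx0 ?mul0mx //.
apply/matrixP => i j; rewrite ord1 !mxE spr horner_map /= r0 ?rmorph0 //.
by apply: map_f; rewrite mem_enum.
Qed.

End Spectrum.

Lemma pdmx_psd (R : realType) (p : nat) (A : 'M[R]_p) : pdmx A -> psdmx A.
Proof.
move=> [sA pA]; split=> // u; have [->|u0] := eqVneq u 0; last exact/ltW/pA.
by rewrite /qform mulmx0 mxE.
Qed.

Lemma horner_mx_tr (R : comNzRingType) (p : nat) (A : 'M[R]_p.+1) (r : {poly R}) :
  (horner_mx A r)^T = horner_mx A^T r.
Proof.
elim/poly_ind: r => [|r c IH]; first by rewrite !rmorph0 trmx0.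
rewrite !rmorphD !rmorphM /= !horner_mx_X !horner_mx_C linearD /= tr_scalar_mx.
by rewrite trmx_mul IH; congr (_ + _); exact: (comm_mx_horner _ (erefl _)).
Qed.

(** If [r] interpolates the fourth root on the spectrum, then C = r(A) is
symmetric with C^4 = A, so C^2 is a square root of A, and C^2 = C^T C is
positive semidefinite. *)
Lemma psd_sqrt_exists (R : realType) (p : nat) (A : 'M[R]_p) : psdmx A ->
  exists B : 'M[R]_p, psdmx B /\ B *m B = A.
Proof.
case: p A => [|p] A psdA.
  exists 0; split; last by apply/matrixP => -[].
  by split; [rewrite trmx0|move=> u; rewrite /qform mulmx0 mul0mx mxE].
have [s s0 sP] := psd_spectrum psdA.
have [r rP] := interpolation (fun x => Num.sqrt (Num.sqrt x)) s.
pose C := horner_mx A r.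
have CT : C^T = C by rewrite /C horner_mx_tr psdA.1.
exists (C *m C); split.
  split; first by rewrite trmx_mul CT.
  by move=> u; rewrite -{1}CT qform_sum_sqr dotvv_ge0.
apply/eqP; rewrite -subr_eq0; apply/eqP.
rewrite -[X in _ - X](horner_mx_X A) /C !mulmxE -!rmorphM -rmorphB /=; apply: sP => x xs.
have y0 := s0 x xs; have sq2 := sqr_sqrtr (sqrtr_ge0 x).
by rewrite hornerD hornerN !hornerM hornerX rP // -!expr2 sq2 sqr_sqrtr ?subrr.
Qed.

(** * Quadratic forms and the operator norm *)

Section LA.
Context {R : realType}.

Section Dot.
Variable p : nat.
Implicit Types (u v w : 'cV[R]_p) (M : 'M[R]_p).

Lemma dotvE u v : dotv u v = \sum_i u i 0 * v i 0.
Proof. by rewrite /dotv mxE; apply: eq_bigr => i _; rewrite mxE. Qed.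

Lemma dotvC u v : dotv u v = dotv v u.
Proof. by rewrite !dotvE; apply: eq_bigr => i _; rewrite mulrC. Qed.

Lemma dotvDr u v w : dotv u (v + w) = dotv u v + dotv u w.
Proof. by rewrite /dotv mulmxDr mxE. Qed.

Lemma dotvZr a u v : dotv u (a *: v) = a * dotv u v.
Proof. by rewrite /dotv -scalemxAr mxE. Qed.

Lemma dotvNr u v : dotv u (- v) = - dotv u v.
Proof. by rewrite -scaleN1r dotvZr mulN1r. Qed.

Lemma dotv0r u : dotv u 0 = 0.
Proof. by rewrite /dotv mulmx0 mxE. Qed.

Lemma dotvDl u v w : dotv (v + w) u = dotv v u + dotv w u.
Proof. by rewrite !(dotvC _ u) dotvDr. Qed.

Lemma dotvZl a u v : dotv (a *: v) u = a * dotv v u.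
Proof. by rewrite !(dotvC _ u) dotvZr. Qed.

Lemma dotvNl u v : dotv (- v) u = - dotv v u.
Proof. by rewrite !(dotvC _ u) dotvNr. Qed.

Lemma dotv0l u : dotv 0 u = 0.
Proof. by rewrite dotvC dotv0r. Qed.

Lemma dotv_suml (I : finType) (F : I -> 'cV[R]_p) u :
  dotv (\sum_i F i) u = \sum_i dotv (F i) u.
Proof.
apply: (big_morph (fun v => dotv v u)) => [v w|]; first exact: dotvDl.
exact: dotv0l.
Qed.

Lemma dotv_mulmxl M u v : dotv (M *m u) v = dotv u (M^T *m v).
Proof. by rewrite /dotv trmx_mul mulmxA. Qed.

Lemma qformE M u : qform M u = dotv u (M *m u).
Proof. by rewrite /qform /dotv mulmxA. Qed.

Lemma qformD M N u : qform (M + N) u = qform M u + qform N u.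
Proof. by rewrite !qformE mulmxDl dotvDr. Qed.

Lemma qformB M N u : qform (M - N) u = qform M u - qform N u.
Proof. by rewrite !qformE mulmxBl dotvDr dotvNr. Qed.

Lemma qformZ a M u : qform (a *: M) u = a * qform M u.
Proof. by rewrite !qformE -scalemxAl dotvZr. Qed.

Lemma qform_scalar a u : qform a%:M u = a * dotv u u.
Proof. by rewrite qformE mul_scalar_mx dotvZr. Qed.

Lemma qform_outer u v : qform (u *m u^T) v = dotv u v ^+ 2.
Proof.
have E : u *m u^T *m v = dotv u v *: u.
  by rewrite -mulmxA (mx11_scalar (u^T *m v)) mul_mx_scalar.
by rewrite qformE E dotvZr dotvC expr2.
Qed.

Lemma qform_sum (I : finType) (F : I -> 'M[R]_p) u :
  qform (\sum_i F i) u = \sum_i qform (F i) u.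
Proof.
apply: (big_morph (fun M => qform M u)) => [M N|]; first exact: qformD.
by rewrite qformE mul0mx dotv0r.
Qed.

(** Common core of the Cauchy-Schwarz inequalities for semidefinite forms and for
expectations. *)
Lemma discriminant_le (a b c : R) : 0 <= c ->
  (forall l, 0 <= a + 2 * l * b + l ^+ 2 * c) -> b ^+ 2 <= a * c.
Proof.
rewrite le_eqVlt => /predU1P[<-|c0] ge0.
  have [->|b0] := eqVneq b 0; first by rewrite mulr0 expr0n.
  have := ge0 (- (a + 1) / (2 * b)); rewrite mulr0 addr0.
  have -> : a + 2 * (- (a + 1) / (2 * b)) * b = - 1 by field.
  by rewrite oppr_ge0 ler10.
have := ge0 (- b / c).
have -> : a + 2 * (- b / c) * b + (- b / c) ^+ 2 * c = (a * c - b ^+ 2) / c.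
  by field; rewrite gt_eqF.
by rewrite pmulr_lge0 ?invr_gt0 // subr_ge0.
Qed.

Lemma psd_cauchy_schwarz M u v : psdmx M ->
  dotv u (M *m v) ^+ 2 <= qform M u * qform M v.
Proof.
move=> [sM pM]; apply: discriminant_le => // l.
have := pM (u + l *: v).
rewrite !qformE mulmxDr -scalemxAr !dotvDr !dotvDl !dotvZr !dotvZl.
have -> : dotv v (M *m u) = dotv u (M *m v) by rewrite dotvC dotv_mulmxl sM.
by congr (_ <= _); ring.
Qed.

Lemma dotv_cauchy_schwarz u v : dotv u v ^+ 2 <= dotv u u * dotv v v.
Proof.
have := @psd_cauchy_schwarz 1%:M u v; rewrite !qformE !mul1mx; apply.
split=> [|w]; first by rewrite trmx1.
by rewrite qformE mul1mx dotvv_ge0.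
Qed.

Lemma enorm_ge0 u : 0 <= enorm u. Proof. exact: sqrtr_ge0. Qed.

Lemma sqr_enorm u : enorm u ^+ 2 = dotv u u.
Proof. by rewrite sqr_sqrtr // dotvv_ge0. Qed.

Lemma enormZ a u : enorm (a *: u) = `|a| * enorm u.
Proof. by rewrite /enorm dotvZl dotvZr mulrA -expr2 sqrtrM ?sqr_ge0 // sqrtr_sqr. Qed.

Lemma enorm_eq0 u : (enorm u == 0) = (u == 0).
Proof.
apply/idP/eqP => [|->]; last by rewrite /enorm dotv0r sqrtr0.
by apply: contraTeq => u0; rewrite gt_eqF // sqrtr_gt0 dotvv_gt0.
Qed.

Lemma pdmx_unit M : pdmx M -> M \in unitmx.
Proof.
move=> [sM pM]; rewrite -row_free_unit -kermx_eq0.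
apply/negP => /negP/rowV0Pn[v /sub_kermxP vM v0].
have : v^T != 0 by rewrite -(inj_eq trmx_inj) trmxK trmx0.
by move=> /pM; rewrite /qform trmxK vM mul0mx mxE ltxx.
Qed.

Lemma invmx_sym M : M^T = M -> (invmx M)^T = invmx M.
Proof. by move=> sM; rewrite trmx_inv sM. Qed.

Lemma qform_inv M u : M \in unitmx -> M^T = M ->
  qform (invmx M) u = qform M (invmx M *m u).
Proof.
by move=> Mu sM; rewrite !qformE dotv_mulmxl invmx_sym // mulKVmx // mulmxA.
Qed.

Lemma pdmx_inv M : pdmx M -> pdmx (invmx M).
Proof.
move=> pdM; have Mu := pdmx_unit pdM; split; first exact: invmx_sym pdM.1.
move=> u u0; rewrite qform_inv //; last exact: pdM.1.
apply: pdM.2; apply: contra u0 => /eqP u0.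
by rewrite -(mulKVmx Mu u) u0 mulmx0.
Qed.

(** The difference of the two sides is the form [M] at u - M^-1 v. The right side
is thus the maximum over [u] of the left side, and a larger [M] has a smaller
inverse. *)
Lemma qform_inv_ge M u v : pdmx M -> 2 * dotv u v - qform M u <= qform (invmx M) v.
Proof.
move=> pdM; have Mu := pdmx_unit pdM; have [sM _] := pdM.
have := (pdmx_psd pdM).2 (u - invmx M *m v).
rewrite qform_inv // !qformE mulmxBr (mulKVmx Mu) !dotvDr !dotvDl !dotvNr !dotvNl.
rewrite (dotv_mulmxl _ v (M *m u)) invmx_sym // (mulKmx Mu) (dotvC v u).
by move=> h; rewrite -subr_ge0; move: h; congr (_ <= _); ring.
Qed.

Lemma qform_inv_anti M N v : pdmx M -> pdmx N ->
  (forall u, qform M u <= qform N u) -> qform (invmx N) v <= qform (invmx M) v.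
Proof.
move=> pdM pdN MN; have Nu := pdmx_unit pdN; have [sN _] := pdN.
apply: le_trans (qform_inv_ge (invmx N *m v) v pdM).
have := MN (invmx N *m v); rewrite -qform_inv // => h.
have -> : dotv (invmx N *m v) v = qform (invmx N) v by rewrite qformE dotvC.
by lra.
Qed.

End Dot.

(** By Cauchy-Schwarz on each row, the Frobenius norm of [M] is an upper bound. *)
Lemma opnorm_has_sup (m p : nat) (M : 'M[R]_(m, p)) :
  has_sup [set enorm (M *m u) | u in [set u : 'cV[R]_p | enorm u <= 1]].
Proof.
split; first by exists (enorm (M *m 0)); exists 0 => //=; rewrite /enorm dotv0r sqrtr0.
exists (Num.sqrt (\sum_i dotv (row i M)^T (row i M)^T)) => _ [v /= v1 <-].
suff bnd : enorm (M *m v) <=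
    Num.sqrt (\sum_i dotv (row i M)^T (row i M)^T) * enorm v.
  by apply: le_trans bnd _; rewrite ler_piMr ?sqrtr_ge0.
rewrite /enorm -sqrtrM ?sumr_ge0 // => [|i _]; last exact: dotvv_ge0.
rewrite ler_sqrt ?mulr_ge0 ?sumr_ge0 ?dotvv_ge0 // => [|i _]; last exact: dotvv_ge0.
rewrite dotvE mulr_suml; apply: ler_sum => i _.
apply: le_trans (dotv_cauchy_schwarz _ _); rewrite -expr2.
suff -> : (M *m v) i 0 = dotv (row i M)^T v by exact: lexx.
by rewrite /dotv trmxK -row_mul [RHS]mxE.
Qed.

Lemma opnorm_ge (m p : nat) (M : 'M[R]_(m, p)) (u : 'cV[R]_p) :
  enorm (M *m u) <= opnorm M * enorm u.
Proof.
have [->|u0] := eqVneq u 0.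
  by rewrite mulmx0 /enorm !dotv0r sqrtr0 mulr0.
have nu : 0 < enorm u by rewrite lt_neqAle enorm_ge0 andbT eq_sym enorm_eq0.
rewrite -ler_pdivrMr // mulrC.
rewrite -[X in X * _]ger0_norm ?invr_ge0 ?enorm_ge0 // -enormZ scalemxAr.
apply: ub_le_sup; first exact: (opnorm_has_sup M).2.
exists ((enorm u)^-1 *: u) => //=.
by rewrite enormZ ger0_norm ?invr_ge0 ?enorm_ge0 // mulVf ?gt_eqF.
Qed.

Lemma opnorm_ge0 (m p : nat) (M : 'M[R]_(m, p)) : 0 <= opnorm M.
Proof.
have n0 : enorm (0 : 'cV[R]_p) = 0 by rewrite /enorm dotv0r sqrtr0.
apply: le_trans (enorm_ge0 (M *m 0)) _.
by apply: (ub_le_sup (opnorm_has_sup M).2); exists 0 => //=; rewrite n0 ler01.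
Qed.

Lemma opnorm_le (m p : nat) (M : 'M[R]_(m, p)) (C : R) :
  (forall u, enorm (M *m u) <= C * enorm u) -> 0 <= C -> opnorm M <= C.
Proof.
move=> h C0; apply: ge_sup.
  by exists (enorm (M *m 0)); exists 0 => //=; rewrite /enorm dotv0r sqrtr0.
move=> _ [v /= v1 <-]; apply: le_trans (h v) _.
by rewrite ler_piMr.
Qed.

Lemma sqrtmxP (p : nat) (A : 'M[R]_p) : psdmx A ->
  psdmx (sqrtmx A) /\ sqrtmx A *m sqrtmx A = A.
Proof.
move=> /psd_sqrt_exists h; rewrite /sqrtmx.
by case: xgetP => [B _ //|] h'; case: h => B /h'.
Qed.

Lemma b_op_ge0 (p : nat) (A S : 'M[R]_p) : 0 <= b_op A S.
Proof. exact: opnorm_ge0. Qed.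

(** With B the square root of [A], S = B N B for the matrix N whose operator norm
is [b_op A S], and B B = A. Later on, the size of [S] is only measured by this
inequality. *)
Lemma qform_le_b_op (p : nat) (A S : 'M[R]_p) u : pdmx A -> psdmx S ->
  qform S u <= b_op A S * qform A u.
Proof.
move=> pdA psdS; have [[sB _] BB] := sqrtmxP (pdmx_psd pdA).
set B := sqrtmx A in sB BB *.
have Bu : B \in unitmx.
  by have := pdmx_unit pdA; rewrite -BB unitmx_mul andbb.
set N := invmx B *m S *m invmx B.
have SE : S = B *m N *m B by rewrite /N !mulmxA mulmxV // mul1mx mulmxKV.
have -> : qform S u = dotv (B *m u) (N *m (B *m u)).
  by rewrite qformE dotv_mulmxl sB SE !mulmxA.
have -> : qform A u = enorm (B *m u) * enorm (B *m u).
  by rewrite -expr2 sqr_enorm -qform_sum_sqr sB BB.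
rewrite mulrA; apply: le_trans (ler_wpM2r (enorm_ge0 _) (opnorm_ge N (B *m u))).
apply: le_trans (ler_norm _) _.
rewrite -(@ler_pXn2r _ 2) ?nnegrE ?mulr_ge0 ?enorm_ge0 //.
by rewrite real_normK ?num_real // exprMn !sqr_enorm mulrC dotv_cauchy_schwarz.
Qed.

End LA.

(** * Resolvents and their rank-one updates *)

Section Resolvent.
Context {R : realType} (p : nat).
Implicit Types (u v w x z : 'cV[R]_p) (M A S : 'M[R]_p).

(** Several forms below are bounded by comparing their square, through
Cauchy-Schwarz, to themselves times the wanted bound. *)
Lemma le_of_sqr_le (a c : R) : 0 <= c -> a ^+ 2 <= c * a -> a <= c.
Proof.
move=> c0; rewrite expr2; have [a0 _|a0] := leP a 0; first exact: le_trans c0.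
by rewrite ler_pM2r.
Qed.

Variables (M S : 'M[R]_p) (t b : R).
Hypotheses (sM : M^T = M) (t0 : 0 < t) (Mt : forall u, t * dotv u u <= qform M u).
Hypotheses (psdS : psdmx S) (b0 : 0 <= b)
  (SM : forall u, qform S u <= b * qform M u).
Let G := invmx M.

Lemma resolvent_pd : pdmx M.
Proof.
split=> // u u0; apply: lt_le_trans (Mt u).
by rewrite mulr_gt0 ?dotvv_gt0.
Qed.

Let Mu : M \in unitmx := pdmx_unit resolvent_pd.
Let sG : G^T = G := invmx_sym sM.

Lemma dotv_resolvent u v : dotv (G *m u) v = dotv u (G *m v).
Proof. by rewrite dotv_mulmxl sG. Qed.

Lemma qform_resolvent_ge0 v : 0 <= qform G v.
Proof. exact: (pdmx_psd (pdmx_inv resolvent_pd)).2. Qed.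

Lemma norm_resolvent v : dotv (G *m v) (G *m v) <= qform G v / t.
Proof. by rewrite ler_pdivlMr // mulrC qform_inv // Mt. Qed.

Lemma qform_resolvent v : qform G v <= dotv v v / t.
Proof.
apply: le_of_sqr_le; first by rewrite divr_ge0 ?dotvv_ge0 // ltW.
rewrite {1}qformE; apply: le_trans (dotv_cauchy_schwarz _ _) _.
rewrite -mulrA ler_wpM2l ?dotvv_ge0 //.
by rewrite mulrC; exact: norm_resolvent.
Qed.

Lemma sandwich_psd : psdmx (G *m S *m G).
Proof.
split; first by rewrite !trmx_mul sG psdS.1 mulmxA.
by move=> v; rewrite qformE -!mulmxA -dotv_resolvent -qformE; exact: psdS.2.
Qed.

Lemma qform_sandwichE v : qform (G *m S *m G) v = qform S (G *m v).
Proof. by rewrite !qformE -!mulmxA -dotv_resolvent. Qed.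

Lemma qform_sandwich v : qform (G *m S *m G) v <= b * qform G v.
Proof. by rewrite qform_sandwichE qform_inv //. Qed.

(** Let Q be the left side and y = S G v. Then Q is the value of the form S at
the vectors G y and G v, so Cauchy-Schwarz for S and S <= b M give
Q^2 <= b (y^T G y) b (v^T G v) = b^2 Q (v^T G v). *)
Lemma qform_resolvent_S v : qform G (S *m (G *m v)) <= b ^+ 2 * qform G v.
Proof.
have c0 : 0 <= b ^+ 2 * qform G v by rewrite mulr_ge0 ?sqr_ge0 ?qform_resolvent_ge0.
apply: le_of_sqr_le => //.
set y := S *m (G *m v).
have E : qform G y = dotv (G *m y) (S *m (G *m v)) by rewrite qformE dotvC.
rewrite {1}E; apply: le_trans (psd_cauchy_schwarz _ _ psdS) _.
have -> : b ^+ 2 * qform G v * qform G y =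
    (b * qform M (G *m y)) * (b * qform M (G *m v)).
  by rewrite -!qform_inv // -/G; ring.
by apply: ler_pM; rewrite ?psdS.2 ?SM.
Qed.

Lemma norm_sandwich v :
  dotv (G *m S *m G *m v) (G *m S *m G *m v) <= b ^+ 2 * qform G v / t.
Proof.
rewrite -!mulmxA; apply: le_trans (norm_resolvent _) _.
by rewrite ler_wpM2r ?qform_resolvent_S // invr_ge0 ltW.
Qed.

(** The matrices G and G S G have norms at most 1/t and b/t; scaled accordingly
they are admissible in the moment bound for quadratic forms. *)
Lemma opnorm_resolvent : opnorm (t *: G) <= 1.
Proof.
apply: opnorm_le => // u; rewrite mul1r -scalemxAl enormZ gtr0_norm //.
rewrite -(@ler_pXn2r _ 2) ?nnegrE ?mulr_ge0 ?enorm_ge0 ?(ltW t0) //.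
rewrite exprMn !sqr_enorm.
have -> : dotv u u = t ^+ 2 * (dotv u u / t / t) by field; rewrite gt_eqF.
rewrite ler_wpM2l ?sqr_ge0 //; apply: le_trans (norm_resolvent u) _.
by rewrite ler_wpM2r ?qform_resolvent // invr_ge0 ltW.
Qed.

Lemma resolvent_psd : psdmx (t *: G).
Proof.
split=> [|u]; first by rewrite linearZ /= sG.
by rewrite qformZ mulr_ge0 ?qform_resolvent_ge0 // ltW.
Qed.

Lemma opnorm_sandwich : 0 < b -> opnorm ((t / b) *: (G *m S *m G)) <= 1.
Proof.
move=> b_gt0; apply: opnorm_le => // u; rewrite mul1r -scalemxAl enormZ.
have tb : 0 < t / b by rewrite divr_gt0.
rewrite gtr0_norm // -(@ler_pXn2r _ 2) ?nnegrE ?(mulr_ge0 (ltW tb)) ?enorm_ge0 //.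
rewrite exprMn !sqr_enorm.
have -> : dotv u u = (t / b) ^+ 2 * (b ^+ 2 * (dotv u u / t) / t).
  by field; rewrite !gt_eqF.
rewrite ler_wpM2l ?sqr_ge0 //; apply: le_trans (norm_sandwich u) _.
rewrite ler_wpM2r ?invr_ge0 ?(ltW t0) //.
by rewrite ler_wpM2l ?sqr_ge0 // qform_resolvent.
Qed.

Lemma sandwich_scaled_psd : psdmx ((t / b) *: (G *m S *m G)).
Proof.
split=> [|u]; first by rewrite linearZ /= sandwich_psd.1.
by rewrite qformZ mulr_ge0 ?divr_ge0 ?sandwich_psd.2 // ltW.
Qed.

Lemma bilinear_resolvent_le u v :
  dotv (G *m u) (S *m (G *m v)) ^+ 2 <= b ^+ 2 * (qform G u * qform G v).
Proof.
apply: le_trans (psd_cauchy_schwarz _ _ psdS) _.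
have -> : b ^+ 2 * (qform G u * qform G v) = (b * qform G u) * (b * qform G v) by ring.
by apply: ler_pM; rewrite ?psdS.2 // qform_inv // SM.
Qed.

End Resolvent.

Section RankOne.
Context {R : realType} (p : nat).
Variables (M S : 'M[R]_p) (z : 'cV[R]_p) (rho : R).
Hypotheses (pdM : pdmx M) (sS : S^T = S) (rho0 : 0 <= rho).
Let G := invmx M.
Let N := M + rho *: (z *m z^T).
Let s := rho * qform G z.
Let c := (1 + s)^-1.

Lemma rank_one_pd : pdmx N.
Proof.
split; first by rewrite /N linearD linearZ /= trmx_mul trmxK pdM.1.
move=> u u0; rewrite qformD qformZ qform_outer ltr_pwDl ?pdM.2 //.
by rewrite mulr_ge0 ?sqr_ge0.
Qed.

Let sG : G^T = G := invmx_sym pdM.1.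

Lemma rank_one_s_ge0 : 0 <= s.
Proof. by rewrite mulr_ge0 // (pdmx_psd (pdmx_inv pdM)).2. Qed.

Lemma rank_one_mul u : N *m u = M *m u + (rho * dotv z u) *: z.
Proof.
rewrite mulmxDl -scalemxAl -mulmxA (mx11_scalar (z^T *m u)) mul_mx_scalar.
by rewrite scalerA.
Qed.

(** The Sherman-Morrison formula, at [z] and then at any vector. *)
Lemma rank_one_inv_z : invmx N *m z = c *: (G *m z).
Proof.
have s0 := rank_one_s_ge0; have Nu := pdmx_unit rank_one_pd.
rewrite -[RHS](mulKmx Nu) rank_one_mul -scalemxAr mulKVmx ?pdmx_unit //.
rewrite dotvZr -qformE -scalerDl (_ : c + _ = 1) ?scale1r //.
have : 1 + s != 0 by rewrite gt_eqF // ltr_pwDl.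
rewrite /c; set g := qform _ _; rewrite /s -/g => h; field; exact: h.
Qed.

Lemma rank_one_inv x :
  invmx N *m x = G *m x - (rho * c * dotv z (G *m x)) *: (G *m z).
Proof.
have Nu := pdmx_unit rank_one_pd.
apply: (canRL (addrK _)); rewrite -[RHS](mulKmx Nu) rank_one_mul.
rewrite mulKVmx ?pdmx_unit // mulmxDr -scalemxAr rank_one_inv_z scalerA.
by rewrite mulrAC.
Qed.

(** The size of [z] enters only through the linear forms [l1] to [l4], apart from
the scalars c and c^2 h. Since 0 <= c <= 1 and c^2 h is bounded as soon as
S <= b M, these scalars cost no moments of [z]. *)
Lemma rank_one_update w x a :
  let l1 := dotv z (G *m S *m G *m x) in let l2 := dotv z (G *m x) in
  let l3 := dotv z (G *m S *m G *m w) in let l4 := dotv z (G *m w) in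
  let h := rho * qform (G *m S *m G) z in
  dotv (invmx N *m (w + a *: z)) (S *m (invmx N *m x)) -
  dotv (G *m w) (S *m (G *m x)) =
  c * (a * l1 - rho * l2 * l3 - rho * l4 * l1) +
  c ^+ 2 * h * (rho * l4 * l2 - a * l2).
Proof.
move=> l1 l2 l3 l4 h.
rewrite mulmxDr -scalemxAr rank_one_inv_z !rank_one_inv -/l2 -/l4.
rewrite !mulmxDr !mulmxN -!scalemxAr !dotvDl !dotvDr !dotvNl !dotvNr !dotvZl !dotvZr.
have E u v : dotv (G *m u) (S *m (G *m v)) = dotv u (G *m S *m G *m v).
  by rewrite dotv_mulmxl sG !mulmxA.
have -> : dotv (G *m w) (S *m (G *m z)) = l3.
  by rewrite dotvC dotv_mulmxl sS E.
rewrite !E -/l1 -qformE /h; ring.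
Qed.

End RankOne.

(** * Expectations of real functions *)

Section Expectation.
Context {d : measure_display} {T : measurableType d} {R : realType}.
Variable P : probability T R.
Implicit Types f g : T -> R.

Definition intg f := P.-integrable setT (EFin \o f).
Definition Ex f : R := \int[P]_w f w.

Lemma ExE f : intg f -> (\int[P]_w (f w)%:E)%E = (Ex f)%:E.
Proof.
move=> If; rewrite /Ex /Rintegral fineK //.
exact: integrable_fin_num.
Qed.

Lemma intg_meas f : intg f -> measurable_fun setT f.
Proof. by move=> /measurable_int /measurable_EFinP. Qed.

Lemma intg_le f g : measurable_fun setT f -> (forall w, `|f w| <= g w) ->
  intg g -> intg f.
Proof.
move=> mf fg; apply: le_integrable => //; first exact/measurable_EFinP.
move=> w _ /=; rewrite lee_fin; apply: le_trans (fg w) _; exact: ler_norm.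
Qed.

Lemma intg_cst (c : R) : intg (fun=> c).
Proof. exact: finite_measure_integrable_cst. Qed.

Lemma Ex_cst (c : R) : Ex (fun=> c) = c.
Proof.
rewrite /Ex Rintegral_cst //.
rewrite [X in fine X](_ : _ = 1%E) ?mulr1 //. exact: probability_setT. 
Qed.

Lemma intg_bounded f (c : R) : measurable_fun setT f -> (forall w, `|f w| <= c) ->
  intg f.
Proof. move=> mf fc; exact: intg_le fc (intg_cst c). Qed.

Lemma intgD f g : intg f -> intg g -> intg (fun w => f w + g w).
Proof. by move=> If Ig; have := integrableD measurableT If Ig. Qed.

Lemma intgZ c f : intg f -> intg (fun w => c * f w).
Proof. by move=> If; have := integrableZl measurableT c If. Qed.

Lemma intgN f : intg f -> intg (fun w => - f w).
Proof. by move=> If; have := integrableN If. Qed.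

Lemma intgB f g : intg f -> intg g -> intg (fun w => f w - g w).
Proof. by move=> If /intgN; exact: intgD. Qed.

Lemma intg_norm f : intg f -> intg (fun w => `|f w|).
Proof. by move=> If; have := integrable_norm If. Qed.

Lemma intg_sum (I : Type) (s : seq I) (F : I -> T -> R) : (forall i, intg (F i)) ->
  intg (fun w => \sum_(i <- s) F i w).
Proof.
move=> IF; elim: s => [|i s IH].
  by under eq_fun do rewrite big_nil; exact: intg_cst.
by under eq_fun do rewrite big_cons; exact: intgD.
Qed.

Lemma ExD f g : intg f -> intg g -> Ex (fun w => f w + g w) = Ex f + Ex g.
Proof. exact: RintegralD. Qed.

Lemma ExB f g : intg f -> intg g -> Ex (fun w => f w - g w) = Ex f - Ex g.
Proof. exact: RintegralB. Qed.

Lemma ExZ c f : intg f -> Ex (fun w => c * f w) = c * Ex f.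
Proof. exact: RintegralZl. Qed.

Lemma Ex_sum (I : Type) (s : seq I) (F : I -> T -> R) : (forall i, intg (F i)) ->
  Ex (fun w => \sum_(i <- s) F i w) = \sum_(i <- s) Ex (F i).
Proof.
move=> IF; elim: s => [|i s IH].
  by rewrite big_nil; under [X in Ex X]eq_fun do rewrite big_nil; exact: Ex_cst.
rewrite big_cons; under [X in Ex X]eq_fun do rewrite big_cons.
by rewrite ExD // ?IH //; exact: intg_sum.
Qed.

Lemma le_Ex f g : intg f -> intg g -> (forall w, f w <= g w) -> Ex f <= Ex g.
Proof. by move=> If Ig fg; apply: le_Rintegral. Qed.

Lemma Ex_ge0 f : (forall w, 0 <= f w) -> 0 <= Ex f.
Proof. by move=> f0; apply: Rintegral_ge0. Qed.

Lemma le_norm_Ex f : intg f -> `|Ex f| <= Ex (fun w => `|f w|).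
Proof. by move=> If; apply: le_normr_Rintegral. Qed.

Lemma intg_of_bound f (c : R) : measurable_fun setT f -> (forall w, 0 <= f w) ->
  (\int[P]_w (f w)%:E <= c%:E)%E -> intg f.
Proof.
move=> mf f0 fc; apply/integrableP; split; first exact/measurable_EFinP.
rewrite (eq_integral (EFin \o f)) => [|w _ /=]; last by rewrite ger0_norm.
exact: le_lt_trans fc (ltry _).
Qed.

Lemma Ex_le_bound f (c : R) : measurable_fun setT f -> (forall w, 0 <= f w) ->
  (\int[P]_w (f w)%:E <= c%:E)%E -> Ex f <= c.
Proof.
move=> mf f0 fc; rewrite -lee_fin -ExE //; exact: intg_of_bound fc.
Qed.

Lemma intg_mul f g : measurable_fun setT f -> measurable_fun setT g ->
  intg (fun w => f w ^+ 2) -> intg (fun w => g w ^+ 2) ->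
  intg (fun w => f w * g w).
Proof.
move=> mf mg If Ig; apply: (@intg_le _ (fun w => f w ^+ 2 + g w ^+ 2)).
- exact: measurable_funM.
- move=> w; rewrite ler_norml; nra.
- exact: intgD.
Qed.

Lemma Ex_cauchy_schwarz f g : measurable_fun setT f -> measurable_fun setT g ->
  intg (fun w => f w ^+ 2) -> intg (fun w => g w ^+ 2) ->
  Ex (fun w => f w * g w) ^+ 2 <= Ex (fun w => f w ^+ 2) * Ex (fun w => g w ^+ 2).
Proof.
move=> mf mg If Ig; have Ifg := intg_mul mf mg If Ig.
apply: discriminant_le => [|l]; first by apply: Ex_ge0 => w; exact: sqr_ge0.
have I2 : intg (fun w => 2 * l * (f w * g w)) by exact: intgZ.
have I3 : intg (fun w => l ^+ 2 * g w ^+ 2) by exact: intgZ.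
have I1 := intgD If I2.
have -> : Ex (fun w => f w ^+ 2) + 2 * l * Ex (fun w => f w * g w) +
    l ^+ 2 * Ex (fun w => g w ^+ 2) = Ex (fun w => (f w + l * g w) ^+ 2).
  rewrite -!ExZ // -!ExD //; congr Ex; apply/funext => w; ring.
by apply: Ex_ge0 => w; exact: sqr_ge0.
Qed.

Lemma Ex_norm_cauchy_schwarz f g (a c : R) :
  measurable_fun setT f -> measurable_fun setT g ->
  intg (fun w => f w ^+ 2) -> intg (fun w => g w ^+ 2) ->
  Ex (fun w => f w ^+ 2) <= a ^+ 2 -> Ex (fun w => g w ^+ 2) <= c ^+ 2 ->
  0 <= a -> 0 <= c -> `|Ex (fun w => f w * g w)| <= a * c.
Proof.
move=> mf mg If Ig fa gc a0 c0.
rewrite -(@ler_pXn2r _ 2) ?nnegrE ?mulr_ge0 // real_normK ?num_real // exprMn.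
apply: le_trans (Ex_cauchy_schwarz mf mg If Ig) _.
by apply: ler_pM => //; apply: Ex_ge0 => w; exact: sqr_ge0.
Qed.

(** Powers with a real exponent are measurable and give the inverse of a positive
number; the inverse of y is y times the inverse of its square. *)
Lemma measurable_inv f : measurable_fun setT f -> (forall w, f w != 0) ->
  measurable_fun setT (fun w => (f w)^-1).
Proof.
move=> mf f0.
rewrite (_ : (fun w => _) = (fun w => f w * powR (f w ^+ 2) (-1))).
  apply: measurable_funM => //.
  exact: (measurableT_comp (measurable_powR (-1 : R)) (measurable_funX 2 mf)).
by apply/funext => w; rewrite powR_inv1 ?sqr_ge0 // expr2 invfM mulrA mulfV ?mul1r.
Qed.

End Expectation.

(** * Moments of linear and quadratic forms in one random vector *)

Section Moments.
Context {d : measure_display} {T : measurableType d} {R : realType}.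
Variable P : probability T R.
Variables (p : nat) (Z : 'I_p -> {RV P >-> R}).

Definition zdot (v : 'cV[R]_p) (w : T) : R := dotv (rvec Z w) v.

Lemma measurable_zdot v : measurable_fun setT (zdot v).
Proof.
rewrite (_ : zdot v = fun w => \sum_i Z i w * v i 0).
  by apply: measurable_sum => i; exact: measurable_funM.
by apply/funext => w; rewrite /zdot dotvE; apply: eq_bigr => i _; rewrite mxE.
Qed.

Lemma linear_moment (k : nat) (beta : R) (v : 'cV[R]_p) :
  linear_moment_bound Z k.+1 beta%:E ->
  intg P (fun w => `|zdot v w| ^+ k.+1) /\
  Ex P (fun w => `|zdot v w| ^+ k.+1) <= enorm v ^+ k.+1 * beta.
Proof.
move=> lb; have [->|v0] := eqVneq v 0.
  rewrite (_ : (fun w => _) = (fun=> 0)); last first.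
    by apply/funext => w; rewrite /zdot dotv0r normr0 exprS mul0r.
  split; first exact: intg_cst.
  by rewrite Ex_cst (_ : enorm _ = 0) ?exprS ?mul0r //; apply/eqP; rewrite enorm_eq0.
have nv : 0 < enorm v by rewrite lt_neqAle enorm_ge0 andbT eq_sym enorm_eq0.
pose u := (enorm v)^-1 *: v.
have u1 : enorm u = 1.
  by rewrite enormZ ger0_norm ?invr_ge0 ?enorm_ge0 // mulVf ?gt_eqF.
have vu w : `|zdot v w| ^+ k.+1 = enorm v ^+ k.+1 * `|zdot u w| ^+ k.+1.
  rewrite -exprMn; congr (_ ^+ _); rewrite /zdot dotvZr normrM mulrA.
  by rewrite ger0_norm ?invr_ge0 ?enorm_ge0 // mulfV ?mul1r ?gt_eqF.
have := lb u u1; rewrite unlock => h.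
have mu : measurable_fun setT (fun w => `|zdot u w| ^+ k.+1).
  apply: measurable_funX; apply: measurableT_comp => //; exact: measurable_zdot.
have u0 w : 0 <= `|zdot u w| ^+ k.+1 by rewrite exprn_ge0.
have Iu := intg_of_bound mu u0 h; have Eu := Ex_le_bound mu u0 h.
rewrite (_ : (fun w => _) = (fun w => enorm v ^+ k.+1 * `|zdot u w| ^+ k.+1)); last first.
  by apply/funext => w; exact: vu.
split; first exact: intgZ.
by rewrite ExZ // ler_wpM2l // exprn_ge0 // enorm_ge0.
Qed.

Variables (beta2 beta4 : R).
Hypotheses (lin2 : linear_moment_bound Z 2 beta2%:E)
  (lin4 : linear_moment_bound Z 4 beta4%:E).

Lemma zdot2 v : intg P (fun w => zdot v w ^+ 2) /\
  Ex P (fun w => zdot v w ^+ 2) <= dotv v v * beta2.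
Proof.
have := linear_moment v lin2.
rewrite sqr_enorm (_ : (fun w => _) = (fun w => zdot v w ^+ 2)) //.
by apply/funext => w; rewrite real_normK ?num_real.
Qed.

Lemma zdot4 v : intg P (fun w => zdot v w ^+ 4) /\
  Ex P (fun w => zdot v w ^+ 4) <= dotv v v ^+ 2 * beta4.
Proof.
have := linear_moment v lin4.
rewrite (exprM _ 2 2) sqr_enorm (_ : (fun w => _) = (fun w => zdot v w ^+ 4)) //.
by apply/funext => w; rewrite !(exprM _ 2 2) real_normK ?num_real.
Qed.

Hypothesis beta4_ge0 : 0 <= beta4.

Lemma zdot22 u v : intg P (fun w => zdot u w ^+ 2 * zdot v w ^+ 2) /\
  Ex P (fun w => zdot u w ^+ 2 * zdot v w ^+ 2) <= dotv u u * dotv v v * beta4.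
Proof.
have [Iu Eu] := zdot4 u; have [Iv Ev] := zdot4 v.
have E2 y : (fun w => zdot y w ^+ 4) = (fun w => (zdot y w ^+ 2) ^+ 2).
  by apply/funext => w; rewrite -exprM.
rewrite !E2 in Iu Eu Iv Ev.
have mz y : measurable_fun setT (fun w => zdot y w ^+ 2).
  by apply: measurable_funX; exact: measurable_zdot.
split; first exact: intg_mul.
have -> : dotv u u * dotv v v * beta4 =
    (dotv u u * Num.sqrt beta4) * (dotv v v * Num.sqrt beta4).
  by rewrite -[in LHS](sqr_sqrtr beta4_ge0); ring.
apply: le_trans (ler_norm _) _; apply: Ex_norm_cauchy_schwarz => //.
- by rewrite exprMn sqr_sqrtr.
- by rewrite exprMn sqr_sqrtr.
- by rewrite mulr_ge0 ?dotvv_ge0 ?sqrtr_ge0.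
- by rewrite mulr_ge0 ?dotvv_ge0 ?sqrtr_ge0.
Qed.

Lemma rv_zdot (j : 'I_p) : (Z j : T -> R) = zdot (delta_mx j 0).
Proof.
apply/funext => w; rewrite /zdot dotvE (bigD1 j) //= !mxE !eqxx mulr1.
by rewrite big1 ?addr0 // => i ij; rewrite !mxE (negbTE ij) mulr0.
Qed.

Lemma intg_rvM (j k : 'I_p) : intg P (fun w => Z j w * Z k w).
Proof.
rewrite !rv_zdot; apply: intg_mul; try exact: measurable_zdot.
- exact: (zdot2 _).1.
- exact: (zdot2 _).1.
Qed.

Variable Sigma : 'M[R]_p.
Hypothesis covZ : centered_with_cov Z Sigma.

(** The trace of N^T Sigma, which is the expectation of Z^T N Z for a centered
vector Z with covariance Sigma. *)
Definition pairing (N : 'M[R]_p) : R := \sum_i \sum_j N i j * Sigma i j.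

Lemma Ex_rvM (j k : 'I_p) : Ex P (fun w => Z j w * Z k w) = Sigma j k.
Proof.
apply: EFin_inj; rewrite -ExE; last exact: intg_rvM.
rewrite -covZ.2 covariance.unlock !covZ.1 expectation.unlock; apply: eq_integral => w _ /=.
by congr EFin; transitivity ((Z j w - 0) * (Z k w - 0)) => //; rewrite !subr0.
Qed.

Lemma intg_rv (j : 'I_p) : intg P (Z j).
Proof.
apply: (@intg_le _ _ _ _ _ (fun w => 1 + Z j w ^+ 2)) => //.
  by move=> w; rewrite ler_norml; nra.
apply: intgD; first exact: intg_cst.
by have := (zdot2 (delta_mx j 0)).1; rewrite -rv_zdot.
Qed.

Lemma Ex_rv (j : 'I_p) : Ex P (Z j) = 0.
Proof.
apply: EFin_inj; rewrite -ExE; last exact: intg_rv.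
transitivity ('E_P[Z j])%E; [by rewrite unlock|exact: covZ.1 j].
Qed.

Lemma intg_zdot v : intg P (zdot v).
Proof.
rewrite (_ : zdot v = fun w => \sum_i v i 0 * Z i w).
  by apply: intg_sum => i; apply: intgZ; exact: intg_rv.
by apply/funext => w; rewrite /zdot dotvC dotvE; apply: eq_bigr => i _; rewrite mxE.
Qed.

Lemma Ex_zdot v : Ex P (zdot v) = 0.
Proof.
rewrite (_ : zdot v = fun w => \sum_i v i 0 * Z i w); last first.
  by apply/funext => w; rewrite /zdot dotvC dotvE; apply: eq_bigr => i _; rewrite mxE.
rewrite Ex_sum => [|i]; last by apply: intgZ; exact: intg_rv.
by rewrite big1 // => i _; rewrite ExZ ?Ex_rv ?mulr0 //; exact: intg_rv.
Qed.

Lemma qform_rvec (N : 'M[R]_p) :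
  (fun w => qform N (rvec Z w)) = (fun w => \sum_i \sum_j N i j * (Z i w * Z j w)).
Proof.
apply/funext => w; rewrite qformE dotvE; apply: eq_bigr => i _.
rewrite !mxE mulr_sumr; apply: eq_bigr => j _; rewrite mxE; ring.
Qed.

Lemma intg_qform N : intg P (fun w => qform N (rvec Z w)).
Proof.
rewrite qform_rvec; apply: intg_sum => i; apply: intg_sum => j.
by apply: intgZ; exact: intg_rvM.
Qed.

Lemma Ex_qform N : Ex P (fun w => qform N (rvec Z w)) = pairing N.
Proof.
have I i j : intg P (fun w => N i j * (Z i w * Z j w)).
  by apply: intgZ; exact: intg_rvM.
rewrite qform_rvec Ex_sum => [|i]; last exact: intg_sum.
apply: eq_bigr => i _; rewrite Ex_sum //; apply: eq_bigr => j _.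
by rewrite ExZ ?Ex_rvM //; exact: intg_rvM.
Qed.

Lemma zdotM u v : (fun w => zdot u w * zdot v w) = (fun w => qform (u *m v^T) (rvec Z w)).
Proof.
apply/funext => w; set z := rvec Z w.
have E : u *m v^T *m z = dotv v z *: u.
  by rewrite -mulmxA (mx11_scalar (v^T *m z)) mul_mx_scalar.
by rewrite qformE E dotvZr /zdot -/z (dotvC v) mulrC.
Qed.

Lemma Ex_zdotM u v : Ex P (fun w => zdot u w * zdot v w) = pairing (u *m v^T).
Proof. by rewrite zdotM Ex_qform. Qed.

Lemma intg_zdotM u v : intg P (fun w => zdot u w * zdot v w).
Proof. by rewrite zdotM; exact: intg_qform. Qed.

Variable betaQ : R.
Hypothesis quad2 : quadratic_moment_bound Z 2 betaQ%:E.

(** The moment bound for a form of operator norm at most [k], by scaling. *)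
Lemma quadratic_moment (N : 'M[R]_p) (k : R) : 0 < k ->
  psdmx (k^-1 *: N) -> opnorm (k^-1 *: N) <= 1 ->
  intg P (fun w => (qform N (rvec Z w) - pairing N) ^+ 2) /\
  Ex P (fun w => (qform N (rvec Z w) - pairing N) ^+ 2) <= k ^+ 2 * betaQ.
Proof.
move=> k0 psdN opN; have := quad2 psdN opN.
set N' := k^-1 *: N.
have EN' : fine 'E_P[fun w => qform N' (rvec Z w)] = pairing N'.
  by rewrite -Ex_qform unlock.
rewrite EN' unlock => h.
have pN : pairing N = k * pairing N'.
  rewrite /pairing mulr_sumr; apply: eq_bigr => i _; rewrite mulr_sumr.
  by apply: eq_bigr => j _; rewrite mxE !mulrA mulfV ?mul1r ?gt_eqF.
have NE : (fun w => (qform N (rvec Z w) - pairing N) ^+ 2) =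
    (fun w => k ^+ 2 * `|qform N' (rvec Z w) - pairing N'| ^+ 2).
  apply/funext => w; rewrite real_normK ?num_real // -exprMn; congr (_ ^+ _).
  by rewrite mulrBr -pN qformZ mulrA mulfV ?mul1r ?gt_eqF.
rewrite NE.
have mN : measurable_fun setT (fun w => `|qform N' (rvec Z w) - pairing N'| ^+ 2).
  apply: measurable_funX; apply: measurableT_comp => //.
  by apply: measurable_funB => //; exact: intg_meas (intg_qform _).
have N0 w : 0 <= `|qform N' (rvec Z w) - pairing N'| ^+ 2 by rewrite exprn_ge0.
split; first by apply: intgZ; exact: intg_of_bound h.
rewrite ExZ; last exact: intg_of_bound h.
by rewrite ler_wpM2l ?sqr_ge0 //; exact: Ex_le_bound h.
Qed.

End Moments.

(** * The increment caused by one random row *)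

Section Stability.
Context {R : realType}.
Implicit Types s h b : R.

Lemma inv1D_range s : 0 <= s -> 0 < (1 + s)^-1 <= 1.
Proof.
move=> s0; have d0 : 0 < 1 + s by lra.
by rewrite invr_gt0 d0 invf_le1 //; lra.
Qed.

Lemma inv1D_dist s s0 : 0 <= s -> 0 <= s0 ->
  ((1 + s)^-1 - (1 + s0)^-1) ^+ 2 <= (s - s0) ^+ 2.
Proof.
move=> s_ge0 s0_ge0.
have e1 : 1 + s != 0 by rewrite gt_eqF //; lra.
have e2 : 1 + s0 != 0 by rewrite gt_eqF //; lra.
have -> : (1 + s)^-1 - (1 + s0)^-1 = (s - s0) * - ((1 + s)^-1 * (1 + s0)^-1).
  by field; rewrite e1 e2.
rewrite exprMn ler_piMr ?sqr_ge0 // sqrrN.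
have := inv1D_range s_ge0; have := inv1D_range s0_ge0.
set c := (1 + s)^-1; set c0 := (1 + s0)^-1 => /andP[? ?] /andP[? ?].
rewrite exprMn mulr_ile1 ?sqr_ge0 ?expr_le1 //; lra.
Qed.

Lemma inv1D_dist1 s s0 : 0 <= s -> 0 <= s0 ->
  ((1 + s)^-1 - (1 + s0)^-1) ^+ 2 <= 1.
Proof.
move=> s_ge0 s0_ge0.
have := inv1D_range s_ge0; have := inv1D_range s0_ge0; nra.
Qed.

Lemma damped_range s h b : 0 <= s -> 0 <= b -> 0 <= h -> h <= b * s ->
  0 <= (1 + s)^-1 ^+ 2 * h <= b.
Proof.
move=> s_ge0 b_ge0 h_ge0 hs; have d0 : 0 < 1 + s by lra.
apply/andP; split; first by rewrite mulr_ge0 // sqr_ge0.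
by rewrite exprVn mulrC ler_pdivrMr ?exprn_gt0 //; nra.
Qed.

(** The two bounds on the fluctuation of c^2 h, this one and [damped_dist], are
the two branches of the minimum in the bound on the mean. *)
Lemma damped_dist1 s s0 h h0 b : 0 <= s -> 0 <= s0 -> 0 <= b ->
  0 <= h -> h <= b * s -> 0 <= h0 -> h0 <= b * s0 ->
  ((1 + s)^-1 ^+ 2 * h - (1 + s0)^-1 ^+ 2 * h0) ^+ 2 <= b ^+ 2.
Proof.
move=> s_ge0 s0_ge0 b_ge0 h_ge0 hs h0_ge0 hs0.
have := damped_range s_ge0 b_ge0 h_ge0 hs.
by have := damped_range s0_ge0 b_ge0 h0_ge0 hs0; nra.
Qed.

(** The function h / (1 + s)^2 is Lipschitz, with constant 1 in h and 2 b in s,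
although h is unbounded: differences of 1 / (1 + s) are multiplied by
h0 / (1 + s0), which is at most b. The coefficients come from
(y + 2 z)^2 <= 3 y^2 + 6 z^2. *)
Lemma damped_dist s s0 h h0 b : 0 <= s -> 0 <= s0 -> 0 <= b ->
  0 <= h -> h <= b * s -> 0 <= h0 -> h0 <= b * s0 ->
  ((1 + s)^-1 ^+ 2 * h - (1 + s0)^-1 ^+ 2 * h0) ^+ 2 <=
  3 * (h - h0) ^+ 2 + 6 * b ^+ 2 * (s - s0) ^+ 2.
Proof.
move=> s_ge0 s0_ge0 b_ge0 h_ge0 hs h0_ge0 hs0.
have e1 : 0 < 1 + s by lra.
have e2 : 0 < 1 + s0 by lra.
set c := (1 + s)^-1; set c0 := (1 + s0)^-1.
have c1 : 0 < c <= 1 := inv1D_range s_ge0.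
have c01 : 0 < c0 <= 1 := inv1D_range s0_ge0.
(* h0 is multiplied by a factor c0 that compensates its size *)
have k0 : 0 <= c0 * h0 <= b.
  rewrite mulr_ge0 //=; last by lra.
  by rewrite mulrC ler_pdivrMr //; nra.
have -> : c ^+ 2 * h - c0 ^+ 2 * h0 =
    c ^+ 2 * (h - h0) + - ((c0 * h0) * ((c + c0) * c)) * (s - s0).
  have -> : s - s0 = c^-1 - c0^-1 by rewrite /c /c0 !invrK; ring.
  by field; rewrite !gt_eqF //; lra.
set x := c ^+ 2 * (h - h0).
have xh : x ^+ 2 <= (h - h0) ^+ 2.
  rewrite exprMn ler_piMl ?sqr_ge0 // !expr_le1 //; try lra.
  by rewrite sqr_ge0.
have q0 : 0 <= (c + c0) * c <= 2 by nra.
have g0 : 0 <= (c0 * h0) * ((c + c0) * c) <= 2 * b.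
  by move: k0 q0; set k := c0 * h0; set q := _ * c; nra.
set g := (c0 * h0) * _ in g0 *.
have gs : (g * (s - s0)) ^+ 2 <= 4 * b ^+ 2 * (s - s0) ^+ 2.
  by rewrite exprMn ler_wpM2r ?sqr_ge0 //; nra.
by have := sqr_ge0 (2 * x + g * (s - s0)); nra.
Qed.

End Stability.

Section OneStep.
Context {d : measure_display} {T : measurableType d} {R : realType}.
Variable P : probability T R.
Variables (p : nat) (Z : 'I_p -> {RV P >-> R}) (Sigma : 'M[R]_p).
Variables (beta2 beta4 : R).
Hypotheses (lin2 : linear_moment_bound Z 2 beta2%:E)
  (lin4 : linear_moment_bound Z 4 beta4%:E)
  (beta2_ge0 : 0 <= beta2) (beta4_ge0 : 0 <= beta4)
  (covZ : centered_with_cov Z Sigma).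
Variables (v1 v2 v3 v4 : 'cV[R]_p) (b kappa t a rho : R).
Hypotheses (b_ge0 : 0 <= b) (kappa_ge0 : 0 <= kappa) (t_gt0 : 0 < t) (rho_ge0 : 0 <= rho).
Hypotheses (nv1 : dotv v1 v1 <= b ^+ 2 * kappa) (nv2 : dotv v2 v2 <= kappa)
  (nv3 : dotv v3 v3 <= b ^+ 2 / t) (nv4 : dotv v4 v4 <= t^-1).

(** In [rank_one_update] the increment is c [coef_c] + c^2 h [coef_c2h]. *)
Definition coef_c w := a * zdot Z v1 w - rho * (zdot Z v2 w * zdot Z v3 w)
   - rho * (zdot Z v4 w * zdot Z v1 w).
Definition coef_c2h w := rho * (zdot Z v4 w * zdot Z v2 w) - a * zdot Z v2 w.
Definition coef_c_mean := - (rho * pairing Sigma (v2 *m v3^T)) -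
  rho * pairing Sigma (v4 *m v1^T).
Definition coef_c2h_mean := rho * pairing Sigma (v4 *m v2^T).
Let W := a ^+ 2 * beta2 + rho ^+ 2 * (beta4 / t).

Lemma W_ge0 : 0 <= W.
Proof.
have u0 : 0 <= beta4 / t by rewrite divr_ge0 // ltW.
by rewrite addr_ge0 // mulr_ge0 ?sqr_ge0.
Qed.

Lemma b2kW_ge0 : 0 <= b ^+ 2 * kappa * W.
Proof. by rewrite mulr_ge0 ?W_ge0 // mulr_ge0 ?sqr_ge0. Qed.

Lemma intg_coef_c : intg P coef_c.
Proof.
have Iz := intg_zdot lin2; have Izz := intg_zdotM lin2.
by apply: intgB; first apply: intgB; apply: intgZ.
Qed.

Lemma intg_coef_c2h : intg P coef_c2h.
Proof.
have Iz := intg_zdot lin2; have Izz := intg_zdotM lin2.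
by apply: intgB; apply: intgZ.
Qed.

Lemma Ex_coef_c : Ex P coef_c = coef_c_mean.
Proof.
have Iz := intg_zdot lin2; have Izz := intg_zdotM lin2.
rewrite ExB; [|by apply: intgB; apply: intgZ|exact: intgZ].
rewrite ExB; [|exact: intgZ|exact: intgZ].
by rewrite !ExZ // (Ex_zdot lin2 covZ) !(Ex_zdotM lin2 covZ) mulr0 sub0r.
Qed.

Lemma Ex_coef_c2h : Ex P coef_c2h = coef_c2h_mean.
Proof.
have Iz := intg_zdot lin2; have Izz := intg_zdotM lin2.
rewrite ExB; [|exact: intgZ|exact: intgZ].
by rewrite !ExZ // (Ex_zdot lin2 covZ) !(Ex_zdotM lin2 covZ) mulr0 subr0.
Qed.

(** The square of a sum of three terms costs a factor 3, and two of the terms are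
products of two linear forms, each bounded by the second summand of W. *)
Lemma coef_c_moment2 : intg P (fun w => coef_c w ^+ 2) /\
  Ex P (fun w => coef_c w ^+ 2) <= 6 * (b ^+ 2 * kappa * W).
Proof.
have [I1 E1] := zdot2 lin2 v1.
have [I23 E23] := zdot22 lin4 beta4_ge0 v2 v3.
have [I41 E41] := zdot22 lin4 beta4_ge0 v4 v1.
pose F w := 3 * (a ^+ 2 * zdot Z v1 w ^+ 2) +
  (3 * (rho ^+ 2 * (zdot Z v2 w ^+ 2 * zdot Z v3 w ^+ 2)) +
   3 * (rho ^+ 2 * (zdot Z v4 w ^+ 2 * zdot Z v1 w ^+ 2))).
have J1 := intgZ 3 (intgZ (a ^+ 2) I1).
have J2 := intgZ 3 (intgZ (rho ^+ 2) I23).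
have J3 := intgZ 3 (intgZ (rho ^+ 2) I41).
have IF : intg P F by apply: intgD => //; exact: intgD.
have PF w : coef_c w ^+ 2 <= F w.
  rewrite /F /coef_c; set x := a * _; set y := rho * (zdot Z v2 w * _).
  set y' := rho * (zdot Z v4 w * _).
  rewrite -!exprMn -/x -/y -/y'.
  by have := sqr_ge0 (x + y); have := sqr_ge0 (x + y'); have := sqr_ge0 (y - y'); nra.
have IP : intg P (fun w => coef_c w ^+ 2).
  apply: intg_le IF => [|w]; last by rewrite ger0_norm ?sqr_ge0.
  by apply: measurable_funX; exact: intg_meas intg_coef_c.
split=> //; apply: le_trans (le_Ex IP IF PF) _.
rewrite /F ExD //; last exact: intgD.
rewrite ExD // !ExZ //; try exact: intgZ.
have t0 : 0 <= t^-1 by rewrite invr_ge0 ltW.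
have F1 : a ^+ 2 * Ex P (fun w => zdot Z v1 w ^+ 2) <= a ^+ 2 * (b ^+ 2 * kappa * beta2).
  by rewrite ler_wpM2l ?sqr_ge0 //; apply: le_trans E1 _; rewrite ler_wpM2r.
have F2 : rho ^+ 2 * Ex P (fun w => zdot Z v2 w ^+ 2 * zdot Z v3 w ^+ 2) <=
    rho ^+ 2 * (kappa * (b ^+ 2 / t) * beta4).
  rewrite ler_wpM2l ?sqr_ge0 //; apply: le_trans E23 _; rewrite ler_wpM2r //.
  by apply: ler_pM => //; exact: dotvv_ge0.
have F3 : rho ^+ 2 * Ex P (fun w => zdot Z v4 w ^+ 2 * zdot Z v1 w ^+ 2) <=
    rho ^+ 2 * (t^-1 * (b ^+ 2 * kappa) * beta4).
  rewrite ler_wpM2l ?sqr_ge0 //; apply: le_trans E41 _; rewrite ler_wpM2r //.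
  by apply: ler_pM => //; exact: dotvv_ge0.
have G1 : 0 <= a ^+ 2 * (b ^+ 2 * kappa * beta2).
  by rewrite mulr_ge0 ?sqr_ge0 // mulr_ge0 // mulr_ge0 ?sqr_ge0.
rewrite /W; nra.
Qed.

Lemma coef_c2h_moment2 : intg P (fun w => coef_c2h w ^+ 2) /\
  Ex P (fun w => coef_c2h w ^+ 2) <= 2 * (kappa * W).
Proof.
have [I1 E1] := zdot2 lin2 v2.
have [I42 E42] := zdot22 lin4 beta4_ge0 v4 v2.
pose F w := 2 * (a ^+ 2 * zdot Z v2 w ^+ 2) +
   2 * (rho ^+ 2 * (zdot Z v4 w ^+ 2 * zdot Z v2 w ^+ 2)).
have J1 := intgZ 2 (intgZ (a ^+ 2) I1).
have J2 := intgZ 2 (intgZ (rho ^+ 2) I42).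
have IF : intg P F by apply: intgD.
have QF w : coef_c2h w ^+ 2 <= F w.
  rewrite /F /coef_c2h; set x := a * _; set y := rho * (zdot Z v4 w * _).
  rewrite -!exprMn -/x -/y; by have := sqr_ge0 (x + y); nra.
have IQ : intg P (fun w => coef_c2h w ^+ 2).
  apply: intg_le IF => [|w]; last by rewrite ger0_norm ?sqr_ge0.
  by apply: measurable_funX; exact: intg_meas intg_coef_c2h.
split=> //; apply: le_trans (le_Ex IQ IF QF) _.
rewrite /F ExD // !ExZ //; try exact: intgZ.
have t0 : 0 <= t^-1 by rewrite invr_ge0 ltW.
have F1 : a ^+ 2 * Ex P (fun w => zdot Z v2 w ^+ 2) <= a ^+ 2 * (kappa * beta2).
  by rewrite ler_wpM2l ?sqr_ge0 //; apply: le_trans E1 _; rewrite ler_wpM2r.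
have F2 : rho ^+ 2 * Ex P (fun w => zdot Z v4 w ^+ 2 * zdot Z v2 w ^+ 2) <=
    rho ^+ 2 * (t^-1 * kappa * beta4).
  rewrite ler_wpM2l ?sqr_ge0 //; apply: le_trans E42 _; rewrite ler_wpM2r //.
  by apply: ler_pM => //; exact: dotvv_ge0.
rewrite /W; nra.
Qed.

Variables (G N : 'M[R]_p).
Hypotheses (G_ge0 : forall z, 0 <= qform G z) (N_ge0 : forall z, 0 <= qform N z)
  (NG : forall z, qform N z <= b * qform G z).
Let s w := rho * qform G (rvec Z w).
Let c w := (1 + s w)^-1.
Let h w := rho * qform N (rvec Z w).
Definition increment w := c w * coef_c w + c w ^+ 2 * h w * coef_c2h w.

Let s_ge0 w : 0 <= s w. Proof. by rewrite mulr_ge0. Qed.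
Let h_ge0 w : 0 <= h w. Proof. by rewrite mulr_ge0. Qed.
Let h_le w : h w <= b * s w.
Proof. by rewrite /h /s mulrCA ler_wpM2l. Qed.
Let intg_s : intg P s. Proof. by apply: intgZ; exact: intg_qform lin2 _. Qed.
Let intg_h : intg P h. Proof. by apply: intgZ; exact: intg_qform lin2 _. Qed.
Let measurable_c : measurable_fun setT c.
Proof.
apply: measurable_inv => [|w]; last by rewrite gt_eqF // ltr_pwDl.
by apply: measurable_funD => //; exact: intg_meas intg_s.
Qed.
Let measurable_c2h : measurable_fun setT (fun w => c w ^+ 2 * h w).
Proof.
apply: measurable_funM; first exact: measurable_funX.
exact: intg_meas intg_h.
Qed.
Let measurable_P : measurable_fun setT coef_c := intg_meas intg_coef_c.
Let measurable_Q : measurable_fun setT coef_c2h := intg_meas intg_coef_c2h.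

Lemma measurable_increment : measurable_fun setT increment.
Proof. by apply: measurable_funD; apply: measurable_funM. Qed.

(** Since c <= 1 and c^2 h <= b, the two parts contribute 2 * 6 and 2 * 2 to the
constant. *)
Lemma increment_moment2 : intg P (fun w => increment w ^+ 2) /\
  Ex P (fun w => increment w ^+ 2) <= 16 * (b ^+ 2 * kappa * W).
Proof.
have [IP EP] := coef_c_moment2; have [IQ EQ] := coef_c2h_moment2.
pose F w := 2 * coef_c w ^+ 2 + 2 * b ^+ 2 * coef_c2h w ^+ 2.
have IF : intg P F by apply: intgD; exact: intgZ.
have DF w : increment w ^+ 2 <= F w.
  rewrite /increment /F.
  have := inv1D_range (s_ge0 w); rewrite -/(c w) => cw.
  have := damped_range (s_ge0 w) b_ge0 (h_ge0 w) (h_le w); rewrite -/(c w).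
  set k := _ * h w; set x := coef_c w; set y := coef_c2h w => k0.
  have cx : (c w * x) ^+ 2 <= x ^+ 2.
    by rewrite exprMn ler_piMl ?sqr_ge0 //; nra.
  have ky : (k * y) ^+ 2 <= b ^+ 2 * y ^+ 2.
    by rewrite exprMn ler_wpM2r ?sqr_ge0 //; nra.
  by have := sqr_ge0 (c w * x - k * y); nra.
have ID : intg P (fun w => increment w ^+ 2).
  apply: intg_le IF => [|w]; last by rewrite ger0_norm ?sqr_ge0.
  by apply: measurable_funX; exact: measurable_increment.
split=> //; apply: le_trans (le_Ex ID IF DF) _.
rewrite /F ExD ?ExZ //; try exact: intgZ.
have F2 : b ^+ 2 * Ex P (fun w => coef_c2h w ^+ 2) <= b ^+ 2 * (2 * (kappa * W)).
  by rewrite ler_wpM2l ?sqr_ge0.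
have := b2kW_ge0.
nra.
Qed.

Let s0 := rho * pairing Sigma G.
Let c0 := (1 + s0)^-1.
Let h0 := rho * pairing Sigma N.
(** The expectation of the increment if s and h did not fluctuate. It depends on
the law of Z only through Sigma. *)
Definition increment_center := c0 * coef_c_mean + c0 ^+ 2 * h0 * coef_c2h_mean.

Variable gamma : R.
Hypothesis gamma_ge0 : 0 <= gamma.
Hypothesis varG : intg P (fun w => (qform G (rvec Z w) - pairing Sigma G) ^+ 2) /\
  Ex P (fun w => (qform G (rvec Z w) - pairing Sigma G) ^+ 2) <= gamma ^+ 2.
Hypothesis varN : intg P (fun w => (qform N (rvec Z w) - pairing Sigma N) ^+ 2) /\
  Ex P (fun w => (qform N (rvec Z w) - pairing Sigma N) ^+ 2) <= b ^+ 2 * gamma ^+ 2.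
Let m := Num.min (rho * gamma) 1.

Let Ex_s : Ex P s = s0.
Proof. by rewrite ExZ ?(Ex_qform lin2 covZ) //; exact: intg_qform lin2 _. Qed.
Let Ex_h : Ex P h = h0.
Proof. by rewrite ExZ ?(Ex_qform lin2 covZ) //; exact: intg_qform lin2 _. Qed.
Let s0_ge0 : 0 <= s0. Proof. by rewrite -Ex_s Ex_ge0. Qed.
Let h0_ge0 : 0 <= h0. Proof. by rewrite -Ex_h Ex_ge0. Qed.
Let h0_le : h0 <= b * s0.
Proof. by rewrite -Ex_h -Ex_s -ExZ // le_Ex //; exact: intgZ. Qed.

Let m_ge0 : 0 <= m.
Proof. by rewrite le_min ler01 andbT mulr_ge0. Qed.

Let var_s : intg P (fun w => (s w - s0) ^+ 2) /\
  Ex P (fun w => (s w - s0) ^+ 2) <= (rho * gamma) ^+ 2.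
Proof.
rewrite (_ : (fun w => _) =
  (fun w => rho ^+ 2 * (qform G (rvec Z w) - pairing Sigma G) ^+ 2)); last first.
  by apply/funext => w; rewrite /s /s0 -mulrBr exprMn.
split; first by apply: intgZ; exact: varG.1.
by rewrite ExZ ?varG.1 // exprMn ler_wpM2l ?sqr_ge0 // varG.2.
Qed.

Let var_h : intg P (fun w => (h w - h0) ^+ 2) /\
  Ex P (fun w => (h w - h0) ^+ 2) <= b ^+ 2 * (rho * gamma) ^+ 2.
Proof.
rewrite (_ : (fun w => _) =
  (fun w => rho ^+ 2 * (qform N (rvec Z w) - pairing Sigma N) ^+ 2)); last first.
  by apply/funext => w; rewrite /h /h0 -mulrBr exprMn.
split; first by apply: intgZ; exact: varN.1.
by rewrite ExZ ?varN.1 // exprMn mulrCA ler_wpM2l ?sqr_ge0 // varN.2.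
Qed.

Let var_c : intg P (fun w => (c w - c0) ^+ 2) /\
  Ex P (fun w => (c w - c0) ^+ 2) <= m ^+ 2.
Proof.
have I : intg P (fun w => (c w - c0) ^+ 2).
  apply: (@intg_bounded _ _ _ _ _ 1) => [|w].
    by apply: measurable_funX; exact: measurable_funB.
  by rewrite ger0_norm ?sqr_ge0 // inv1D_dist1.
split=> //; rewrite /m; have [_|_] := leP (rho * gamma) 1.
  apply: le_trans var_s.2; apply: le_Ex => //; first exact: var_s.1.
  by move=> w; exact: inv1D_dist.
rewrite expr1n -[leRHS](Ex_cst P); apply: le_Ex => //; first exact: intg_cst.
by move=> w; exact: inv1D_dist1.
Qed.

Let var_c2h : intg P (fun w => (c w ^+ 2 * h w - c0 ^+ 2 * h0) ^+ 2) /\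
  Ex P (fun w => (c w ^+ 2 * h w - c0 ^+ 2 * h0) ^+ 2) <= (3 * b * m) ^+ 2.
Proof.
have D1 w : (c w ^+ 2 * h w - c0 ^+ 2 * h0) ^+ 2 <= b ^+ 2 by exact: damped_dist1.
have I : intg P (fun w => (c w ^+ 2 * h w - c0 ^+ 2 * h0) ^+ 2).
  apply: (@intg_bounded _ _ _ _ _ (b ^+ 2)) => [|w]; last by rewrite ger0_norm ?sqr_ge0.
  by apply: measurable_funX; exact: measurable_funB.
split=> //; rewrite /m; have [_|_] := leP (rho * gamma) 1.
  have [Is Es] := var_s; have [Ih Eh] := var_h.
  apply: le_trans (_ : Ex P (fun w => 3 * (h w - h0) ^+ 2 + 6 * b ^+ 2 * (s w - s0) ^+ 2) <= _).
    apply: le_Ex => // [|w]; first by apply: intgD; exact: intgZ.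
    exact: damped_dist.
  rewrite ExD ?ExZ //; try exact: intgZ.
  have : b ^+ 2 * Ex P (fun w => (s w - s0) ^+ 2) <= b ^+ 2 * (rho * gamma) ^+ 2.
    by rewrite ler_wpM2l ?sqr_ge0.
  by nra.
apply: le_trans (_ : Ex P (fun=> b ^+ 2) <= _).
  by apply: le_Ex => //; exact: intg_cst.
by rewrite Ex_cst; nra.
Qed.

(** After c is replaced by [c0] and c^2 h by [c0 ^+ 2 * h0], there remain the
expectations of [coef_c] and [coef_c2h] times the replacement errors.
Cauchy-Schwarz bounds them by m times 3 K and 3 b m times 2 sqrt(kappa W), with
K = b sqrt(kappa W). *)
Lemma increment_mean : intg P increment /\
  `|Ex P increment - increment_center| <= 9 * (b * Num.sqrt kappa * Num.sqrt W * m).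
Proof.
have [IP EP] := coef_c_moment2; have [IQ EQ] := coef_c2h_moment2.
have [Ic Ec] := var_c; have [Ik Ek] := var_c2h.
have mc : measurable_fun setT (fun w => c w - c0) by exact: measurable_funB.
have mk : measurable_fun setT (fun w => c w ^+ 2 * h w - c0 ^+ 2 * h0).
  exact: measurable_funB.
have I1 := intg_mul mc measurable_P Ic IP.
have I2 := intg_mul mk measurable_Q Ik IQ.
have J1 := intgZ c0 intg_coef_c; have J2 := intgZ (c0 ^+ 2 * h0) intg_coef_c2h.
have DE : increment = fun w => ((c0 * coef_c w + c0 ^+ 2 * h0 * coef_c2h w) +
    ((c w - c0) * coef_c w + (c w ^+ 2 * h w - c0 ^+ 2 * h0) * coef_c2h w)).
  by apply/funext => w; rewrite /increment; ring.
split; first by rewrite DE; apply: intgD; exact: intgD.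
rewrite DE ExD; [|exact: intgD|exact: intgD].
rewrite ExD // (ExD I1 I2) (ExZ _ intg_coef_c) (ExZ _ intg_coef_c2h) Ex_coef_c Ex_coef_c2h.
rewrite -/increment_center addrC addKr; apply: le_trans (ler_normD _ _) _.
have W0 := W_ge0; set K := b * Num.sqrt kappa * Num.sqrt W.
have K0 : 0 <= K by rewrite !mulr_ge0 ?sqrtr_ge0.
have B1 : `|Ex P (fun w => (c w - c0) * coef_c w)| <= m * (3 * K).
  apply: Ex_norm_cauchy_schwarz => //; last by rewrite mulr_ge0.
  apply: le_trans EP _; rewrite !exprMn !sqr_sqrtr //.
  have := b2kW_ge0.
  by nra.
have B2 : `|Ex P (fun w => (c w ^+ 2 * h w - c0 ^+ 2 * h0) * coef_c2h w)| <=
    (3 * b * m) * (2 * (Num.sqrt kappa * Num.sqrt W)).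
  apply: Ex_norm_cauchy_schwarz => //; try by rewrite !mulr_ge0 ?sqrtr_ge0.
  apply: le_trans EQ _; rewrite !exprMn !sqr_sqrtr //.
  have : 0 <= kappa * W by rewrite mulr_ge0.
  by nra.
rewrite (_ : 9 * (K * m) = m * (3 * K) + 3 * b * m * (2 * (Num.sqrt kappa * Num.sqrt W))).
  exact: lerD.
by rewrite /K; ring.
Qed.

End OneStep.

(** * Decoupling independent rows *)

Section PiSystems.
Context {d : measure_display} {T : measurableType d} {R : realType}.
Variable P : probability T R.

(** The two sides are finite measures in [A]; they agree on a class stable under
intersection, hence on the sigma-algebra that it generates. *)
Lemma independence_extend (G : set (set T)) (B : set T) :
  G `<=` measurable -> setI_closed G -> G setT -> measurable B ->
  (forall A, G A -> P (A `&` B) = (P A * P B)%E) ->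
  forall A, <<s G >> A -> P (A `&` B) = (P A * P B)%E.
Proof.
move=> Gm GI GT mB GB A sA.
have PB0 : 0 <= fine (P B) by rewrite fine_ge0 // measure_ge0.
pose r := NngNum PB0.
have PBE : (P B = (r%:num)%:E)%E.
  by rewrite /= fineK // fin_num_measure.
have -> : P (A `&` B) = mrestr P mB A by [].
have -> : (P A * P B = mscale r P A)%E by rewrite PBE muleC.
apply: (@g_sigma_algebra_measure_unique _ _ _ G Gm (fun=> setT)) => //.
- by rewrite bigcup_const //; exists 0%N.
- by move=> C GC; rewrite -[LHS]/(P (C `&` B)) GB // PBE muleC.
- by move=> _; rewrite /mrestr; apply: le_lt_trans (probability_le1 _ _) (ltry 1); exact: measurableI.
Qed.

Lemma independence_pi (G1 G2 : set (set T)) :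
  G1 `<=` measurable -> setI_closed G1 -> G1 setT ->
  G2 `<=` measurable -> setI_closed G2 -> G2 setT ->
  (forall A B, G1 A -> G2 B -> P (A `&` B) = (P A * P B)%E) ->
  forall A B, <<s G1 >> A -> <<s G2 >> B -> P (A `&` B) = (P A * P B)%E.
Proof.
move=> G1m G1I G1T G2m G2I G2T G12 A B sA sB.
have s1m : <<s G1 >> `<=` measurable.
  by apply: smallest_sub => //; exact: sigma_algebra_measurable.
have s2m : <<s G2 >> `<=` measurable.
  by apply: smallest_sub => //; exact: sigma_algebra_measurable.
rewrite setIC muleC; apply: (independence_extend G2m) => //; first exact: s1m.
move=> C GC; rewrite setIC muleC; apply: (independence_extend G1m) => //.
  exact: G2m.
by move=> D GD; exact: G12.
Qed.

End PiSystems.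

Section Decoupling.
Context {d : measure_display} {T : measurableType d} {R : realType}.
Variable P : probability T R.
Variables (n p : nat).

Lemma sigma_vec_measurable (Z : 'I_p -> {RV P >-> R}) : sigma_vec Z `<=` measurable.
Proof.
apply: smallest_sub; first exact: sigma_algebra_measurable.
apply: (big_ind (fun S : set (set T) => S `<=` measurable)) => //.
- by move=> S1 S2 h1 h2 A [/h1|/h2].
- by move=> j _ A [B mB <-]; exact: (measurable_funPT (Z j)).
Qed.

Lemma sigma_vec_preimage (Z : 'I_p -> {RV P >-> R}) j (B : set R) :
  measurable B -> sigma_vec Z (Z j @^-1` B).
Proof.
move=> mB; apply: sub_sigma_algebra; rewrite (bigD1 j) //=.
by left; exists B => //; rewrite setTI.
Qed.

Variable X : 'I_n -> 'I_p -> {RV P >-> R}.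
Hypothesis indX : mutually_independent X.

(** A class stable under intersection that generates the sigma-algebra of the rows
with index in [J], and on which independence is the defining product rule. *)
Definition rect (J : {set 'I_n}) : set (set T) :=
  [set A | exists2 E : 'I_n -> set T, (forall i, sigma_vec (X i) (E i)) &
           A = \bigcap_(i in [set` J]) E i].

Lemma sigma_vecT i : sigma_vec (X i) setT.
Proof. by rewrite -(setC0); apply: sigma_algebraC; exact: sigma_algebra0. Qed.

Lemma rectT J : rect J setT.
Proof.
exists (fun=> setT) => [i|]; first exact: sigma_vecT.
by apply/esym; rewrite -subTset => w _ i.
Qed.

Lemma rectI J : setI_closed (rect J).
Proof.
move=> _ _ [E sE ->] [F sF ->]; exists (fun i => E i `&` F i); last by rewrite bigcapI.
move=> i.
pose G := \big[setU/set0]_(j < p) preimage_set_system setT (X i j : T -> R) measurable.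
exact: (@measurableI _ (g_sigma_algebraType G) _ _ (sE i) (sF i)).
Qed.

Lemma rect_measurable J : rect J `<=` measurable.
Proof.
move=> _ [E sE ->]; apply: fin_bigcap_measurable => // i _.
by apply: sigma_vec_measurable; exact: sE.
Qed.

Lemma rect_indep (J : {set 'I_n}) A B : rect J A -> rect (~: J) B ->
  P (A `&` B) = (P A * P B)%E.
Proof.
move=> [E sE ->] [F sF ->].
pose EF i := if i \in J then E i else F i.
have -> : (\bigcap_(i in [set` J]) E i) `&` (\bigcap_(i in [set` ~: J]) F i) =
    \bigcap_(i in [set` [set: 'I_n]%SET]) EF i.
  apply/seteqP; split=> w.
    move=> [wE wF] i _; rewrite /EF; case: ifPn => iJ; first exact: wE.
    by apply: wF => /=; rewrite inE.
  move=> wEF; split=> i /= iJ; have := wEF i; rewrite /EF.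
    by rewrite iJ; apply; rewrite /= inE.
  by move: iJ; rewrite inE => /negbTE ->; apply; rewrite /= inE.
rewrite !indX //; last by move=> i _; rewrite /EF; case: ifP.
rewrite (bigID (mem J)) /=; congr (_ * _)%E.
  rewrite [LHS](eq_bigl (fun i => i \in J)) => [|i]; last by rewrite !inE.
  by apply: eq_bigr => i iJ; rewrite /EF iJ.
rewrite [LHS](eq_bigl (fun i => i \in ~: J)) => [|i]; last by rewrite !inE.
by apply: eq_bigr => i; rewrite inE /EF => /negbTE ->.
Qed.

Let TJ (J : {set 'I_n}) := g_sigma_algebraType (rect J).

Lemma block_independent (J : {set 'I_n}) A B :
  <<s rect J >> A -> <<s rect (~: J) >> B -> P (A `&` B) = (P A * P B)%E.
Proof.
apply: independence_pi; [exact: rect_measurable|exact: rectI|exact: rectT|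
  exact: rect_measurable|exact: rectI|exact: rectT|exact: rect_indep].
Qed.

Lemma measurable_row (J : {set 'I_n}) i j : i \in J ->
  measurable_fun (setT : set (TJ J)) (X i j : TJ J -> R).
Proof.
move=> iJ _ B mB; rewrite setTI; apply: sub_sigma_algebra.
exists (fun k => if k == i then X i j @^-1` B else setT).
  move=> k; case: eqP => [->|_]; last exact: sigma_vecT.
  exact: sigma_vec_preimage.
apply/seteqP; split=> w /=.
  by move=> wB k _ /=; case: eqP.
by move=> /(_ i iJ); rewrite eqxx.
Qed.

(** Borel measurability in the entries, expressed by composition with all
measurable families of entries. In this form it is stable under substituting
constants or other random variables for some of the rows. *)
Definition measurable_mxfun (Phi : 'M[R]_(n, p) -> R) : Prop :=
  forall d' (T' : measurableType d') (f : T' -> 'M[R]_(n, p)),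
    (forall i j, measurable_fun setT (fun w => f w i j)) ->
    measurable_fun setT (fun w => Phi (f w)).

Definition mix (J : {set 'I_n}) (A B : 'M[R]_(n, p)) : 'M[R]_(n, p) :=
  \matrix_(i, j) if i \in J then A i j else B i j.

(** Give one copy of the sample space the sigma-algebra of the rows in [J] and
another copy that of the remaining rows. By independence the image of [P] under
the diagonal map into their product is the product measure, and Fubini applies:
the function is measurable for it because each entry of the mixed matrix is
measurable for the copy that it comes from. *)
Lemma decouple (J : {set 'I_n}) (Phi : 'M[R]_(n, p) -> R) (C : R) :
  measurable_mxfun Phi -> (forall x, `|Phi x| <= C) ->
  Ex P (fun w => Phi (rmx X w)) =
  Ex P (fun w => Ex P (fun w' => Phi (mix J (rmx X w) (rmx X w')))).
Proof.
move=> mPhi PhiC.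
have idm (K : {set 'I_n}) : measurable_fun (setT : set T) (id : T -> TJ K).
  move=> _ B sB; rewrite setTI.
  suff : <<s rect K >> `<=` measurable by apply.
  by apply: smallest_sub; [exact: sigma_algebra_measurable|exact: rect_measurable].
pose i1 : {mfun T >-> TJ J} := HB.pack (id : T -> TJ J)
  (isMeasurableFun.Build _ _ _ _ _ (idm J)).
pose i2 : {mfun T >-> TJ (~: J)} := HB.pack (id : T -> TJ (~: J))
  (isMeasurableFun.Build _ _ _ _ _ (idm (~: J))).
pose dg : {mfun T >-> (TJ J * TJ (~: J))%type} :=
  HB.pack (fun w : T => (w : TJ J, w : TJ (~: J)))
  (isMeasurableFun.Build _ _ _ _ _ (measurable_fun_pair (idm J) (idm (~: J)))).
pose P1 := distribution P i1; pose P2 := distribution P i2.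
pose F (z : TJ J * TJ (~: J)) := (Phi (mix J (rmx X z.1) (rmx X z.2)))%:E.
have mF : measurable_fun setT F.
  apply/measurable_EFinP; apply: mPhi => i j.
  under eq_fun do rewrite mxE.
  have [iJ|iJ] := boolP (i \in J).
    rewrite (_ : (fun w => _) = (X i j : TJ J -> R) \o fst).
      by apply: measurableT_comp; [exact: measurable_row|exact: measurable_fst].
    by apply/funext => z /=; rewrite mxE.
  rewrite (_ : (fun w => _) = (X i j : TJ (~: J) -> R) \o snd).
    by apply: measurableT_comp; [apply: measurable_row; rewrite inE|exact: measurable_snd].
  by apply/funext => z /=; rewrite mxE.
have prodE (A : set (TJ J * TJ (~: J))) : measurable A ->
    (P1 \x P2)%E A = distribution P dg A.
  apply: product_measure_unique => B C' mB mC.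
  transitivity (P ((B : set T) `&` (C' : set T))); first by [].
  rewrite (block_independent mB mC). by [].
have F_bnd z : `|Phi (mix J (rmx X z.1) (rmx X z.2))| <= C by exact: PhiC.
have IF : (P1 \x P2)%E.-integrable setT F.
  apply: measurable_bounded_integrable => //.
  - by rewrite [X in (X < _)%E](prodE setT measurableT) [X in (X < _)%E]probability_setT ltry.
  - exact/measurable_EFinP.
  - exists C; split; first exact: num_real.
    by move=> y Cy z _; apply: le_trans (F_bnd z) (ltW Cy).
have IPhi : intg P (fun w => Phi (rmx X w)).
  apply: (@intg_bounded _ _ _ _ _ C) => [|w] //; apply: mPhi => i j.
  by under eq_fun do rewrite mxE; exact: measurable_funPT.
have Isec w : intg P (fun w' => Phi (mix J (rmx X w) (rmx X w'))).
  apply: (@intg_bounded _ _ _ _ _ C) => [|w'] //; apply: mPhi => i j.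
  under eq_fun do rewrite mxE.
  case: (boolP (i \in J)) => _; first exact: measurable_cst.
  by under eq_fun do rewrite mxE; exact: measurable_funPT.
have inner x : fubini_F P2 F x = (Ex P (fun w' => Phi (mix J (rmx X x) (rmx X w'))))%:E.
  rewrite -ExE // /fubini_F; apply: integral_distribution; last exact: Isec.
  exact: measurableT_comp mF (measurable_pair1 _).
apply: EFin_inj; rewrite -ExE //.
have -> : (\int[P]_w (Phi (rmx X w))%:E = \int[P]_w (F \o dg) w)%E.
  apply: eq_integral => w _; congr (Phi _)%:E.
  by apply/matrixP => i j; rewrite !mxE; case: ifP.
have Idg : P.-integrable setT (F \o dg).
  have := IPhi; rewrite /intg; congr (P.-integrable _ _).
  apply/funext => w; congr (Phi _)%:E.
  by apply/matrixP => i j; rewrite !mxE; case: ifP.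
rewrite -(integral_distribution mF Idg).
have -> : (\int[distribution P dg]_z F z = \int[(P1 \x P2)%E]_z F z)%E.
  by apply: eq_measure_integral => A mA _; apply/esym; exact: prodE.
rewrite -(integral12_prod_meas1 IF).
have mFF := measurable_fubini_F IF.
have IO : intg P (fun w => Ex P (fun w' => Phi (mix J (rmx X w) (rmx X w')))).
  apply: (@intg_bounded _ _ _ _ _ C) => [|w].
    apply/measurable_EFinP; rewrite (_ : _ \o _ = fubini_F P2 F \o i1).
      exact: measurableT_comp.
    by apply/funext => w /=; rewrite inner.
  apply: le_trans (le_norm_Ex (Isec w)) _.
  rewrite -[leRHS](Ex_cst P); apply: le_Ex => //; [exact: intg_norm|exact: intg_cst].
rewrite -ExE // (integral_distribution (X := i1) mFF); last first.
  by move: IO; rewrite /intg; congr (P.-integrable _ _); apply/funext => w /=; rewrite inner.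
by apply: eq_integral => w _ /=; rewrite inner.
Qed.

End Decoupling.

(** * The Efron-Stein inequality *)

Section EfronStein.
Context {d : measure_display} {T : measurableType d} {R : realType}.
Variable P : probability T R.
Variables (n p : nat).
Implicit Types (Phi : 'M[R]_(n, p) -> R) (J : {set 'I_n}) (A B : 'M[R]_(n, p)).

Lemma mix_sub J (K : {set 'I_n}) A B (C : 'M[R]_(n, p)) : J \subset K -> mix J (mix K A B) C = mix J A C.
Proof.
move=> /fintype.subsetP JK; apply/matrixP => i j; rewrite !mxE.
by case: ifPn => // /JK ->.
Qed.

Lemma mix_setT A B : mix [set: 'I_n] A B = A.
Proof. by apply/matrixP => i j; rewrite !mxE inE. Qed.

Lemma mix_set0 A B : mix finset.set0 A B = B.
Proof. by apply/matrixP => i j; rewrite !mxE inE. Qed.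

Variable X : 'I_n -> 'I_p -> {RV P >-> R}.
Hypothesis indX : mutually_independent X.

(** At the data matrix itself this is the conditional expectation of [Phi] given
the rows in [J]. *)
Definition average J Phi A : R := Ex P (fun w => Phi (mix J A (rmx X w))).

Lemma intg_mxfun (C : R) Phi : measurable_mxfun Phi -> (forall x, `|Phi x| <= C) ->
  intg P (fun w => Phi (rmx X w)).
Proof.
move=> mPhi PhiC; apply: (@intg_bounded _ _ _ _ _ C) => [|w] //; apply: mPhi => i j.
by under eq_fun do rewrite mxE; exact: measurable_funPT.
Qed.

Lemma measurable_mix J Phi A : measurable_mxfun Phi ->
  measurable_mxfun (fun B => Phi (mix J A B)).
Proof.
move=> mPhi d' T' f mf; apply: mPhi => i j; under eq_fun do rewrite mxE.
by case: (boolP (i \in J)) => _; [exact: measurable_cst|exact: mf].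
Qed.

Section Average.
Variables (C : R) (Phi : 'M[R]_(n, p) -> R) (J : {set 'I_n}).
Hypotheses (mPhi : measurable_mxfun Phi) (PhiC : forall x, `|Phi x| <= C).

Lemma intg_mix A : intg P (fun w => Phi (mix J A (rmx X w))).
Proof.
by apply: (@intg_mxfun C (fun B => Phi (mix J A B))) => //; exact: measurable_mix.
Qed.

Lemma average_bounded A : `|average J Phi A| <= C.
Proof.
apply: le_trans (le_norm_Ex (intg_mix A)) _.
rewrite -[leRHS](Ex_cst P); apply: le_Ex => //; last exact: intg_cst.
by apply: intg_norm; exact: intg_mix.
Qed.

Lemma measurable_average : measurable_mxfun (average J Phi).
Proof.
move=> d' T' f mf.
pose F (z : T' * T) := (Phi (mix J (f z.1) (rmx X z.2)) + C)%:E.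
have mF : measurable_fun setT F.
  apply/measurable_EFinP; apply: measurable_funD => //; apply: mPhi => i j.
  under eq_fun do rewrite mxE; have [iJ|iJ] := boolP (i \in J).
    exact: (measurableT_comp (mf i j) measurable_fst).
  under eq_fun do rewrite mxE.
  by apply: (measurableT_comp _ measurable_snd); exact: measurable_funPT.
have F0 z : (0 <= F z)%E.
  by rewrite lee_fin; have := PhiC (mix J (f z.1) (rmx X z.2)); rewrite ler_norml; lra.
have mFF := measurable_fun_fubini_tonelli_F (m2 := P) F mF F0.
rewrite (_ : (fun w => _) = (fun w => fine (fubini_F P F w) - C)).
  by apply: measurable_funB => //; exact: measurableT_comp mFF.
apply/funext => w; rewrite /fubini_F /F /average.
have Im := intg_mix (f w); have Ic := intg_cst P C.
by rewrite (ExE (intgD Im Ic)) /= ExD // Ex_cst addrK.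
Qed.

End Average.

Lemma mxfunM Phi Psi : measurable_mxfun Phi -> measurable_mxfun Psi ->
  measurable_mxfun (fun x => Phi x * Psi x).
Proof. by move=> h1 h2 d' T' f mf; apply: measurable_funM; [exact: h1|exact: h2]. Qed.

Lemma mxfunB Phi Psi : measurable_mxfun Phi -> measurable_mxfun Psi ->
  measurable_mxfun (fun x => Phi x - Psi x).
Proof. by move=> h1 h2 d' T' f mf; apply: measurable_funB; [exact: h1|exact: h2]. Qed.

Variables (C : R) (F : 'M[R]_(n, p) -> R) (L : 'I_n -> 'M[R]_(n, p) -> R).
Hypotheses (mF : measurable_mxfun F) (FC : forall x, `|F x| <= C).
Hypotheses (mL : forall k, measurable_mxfun (L k)) (LC : forall k x, `|L k x| <= C).
Hypothesis L_loo : forall k (x y : 'M[R]_(n, p)),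
  (forall i j, i != k -> x i j = y i j) -> L k x = L k y.

Let J (k : nat) : {set 'I_n} := [set i : 'I_n | (i < k)%N]%SET.
Let f k w := average (J k) F (rmx X w).

(** Let [f k] be the conditional expectation of F given the rows before [k], and
g that of [L k]. Since [L k] ignores row [k], g is also its conditional
expectation given the rows up to [k], so that f (k+1) - g is a conditional
expectation of F - L k and its second moment is at most that of F - L k. On the
other hand g depends on the rows before [k] only, hence [f k] and f (k+1) have
the same inner product with g as F, and the second moment of f (k+1) - g exceeds
E f(k+1)^2 - E f(k)^2 by that of f k - g. *)
Lemma efron_stein_step (k : 'I_n) :
  Ex P (fun w => f k.+1 w ^+ 2) - Ex P (fun w => f k w ^+ 2) <=
  Ex P (fun w => (F (rmx X w) - L k (rmx X w)) ^+ 2).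
Proof.
pose g' := average (J k) (L k); pose g w := g' (rmx X w).
have mg' : measurable_mxfun g' := measurable_average (J k) (mL k) (LC k).
have g'C x : `|g' x| <= C := average_bounded (J k) (mL k) (LC k) x.
have mf' j : measurable_mxfun (average (J j) F) := measurable_average (J j) mF FC.
have f'C j x : `|average (J j) F x| <= C := average_bounded (J j) mF FC x.
have prodC a b : `|a| <= C -> `|b| <= C -> `|a * b| <= C * C.
  by move=> h1 h2; rewrite normrM ler_pM.
have Iff j : intg P (fun w => f j w ^+ 2).
  apply: (@intg_mxfun (C * C) (fun x => average (J j) F x ^+ 2)); first exact: mxfunM.
  by move=> x; rewrite expr2; exact: prodC.
have Igg : intg P (fun w => g w ^+ 2).
  apply: (@intg_mxfun (C * C) (fun x => g' x ^+ 2)); first exact: mxfunM.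
  by move=> x; rewrite expr2; exact: prodC.
have Ifg j : intg P (fun w => f j w * g w).
  apply: (@intg_mxfun (C * C) (fun x => average (J j) F x * g' x)); first exact: mxfunM.
  by move=> x; exact: prodC.
have Efg j : (k <= j)%N -> Ex P (fun w => f j w * g w) = Ex P (fun w => F (rmx X w) * g w).
  move=> kj; rewrite (decouple indX (J j) (mxfunM mF mg') (C := C * C)); last first.
    by move=> x; exact: prodC.
  congr Ex; apply/funext => w; rewrite /f /average mulrC -ExZ; last exact: (intg_mix _ mF FC).
  congr Ex; apply/funext => w' /=; rewrite mulrC; congr (_ * _).
  rewrite /g /g' /average; congr Ex; apply/funext => v; congr (L k _).
  rewrite mix_sub //; apply/fintype.subsetP => i; rewrite !inE => ik.
  exact: leq_trans ik kj.
have Esq j : (k <= j)%N -> Ex P (fun w => (f j w - g w) ^+ 2) =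
    Ex P (fun w => f j w ^+ 2) - 2 * Ex P (fun w => F (rmx X w) * g w) +
    Ex P (fun w => g w ^+ 2).
  move=> kj; rewrite -(Efg j kj) -ExZ // -ExB //; last exact: intgZ.
  rewrite -ExD //; last by apply: intgB => //; exact: intgZ.
  by congr Ex; apply/funext => w; ring.
have step : Ex P (fun w => f k.+1 w ^+ 2) - Ex P (fun w => f k w ^+ 2) <=
    Ex P (fun w => (f k.+1 w - g w) ^+ 2).
  have alg (u v m e : R) : 0 <= u - 2 * m + e -> v - u <= v - 2 * m + e by lra.
  by rewrite Esq //; apply: alg; rewrite -Esq //; apply: Ex_ge0 => w; exact: sqr_ge0.
apply: le_trans step _.
pose D x := F x - L k x.
have mD : measurable_mxfun D := mxfunB mF (mL k).
have DC x : `|D x| <= C + C by apply: le_trans (ler_normB _ _) _; exact: lerD.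
have D2C x : `|D x ^+ 2| <= (C + C) * (C + C) by rewrite normrX expr2 ler_pM.
rewrite (decouple indX (J k.+1) (mxfunM mD mD) (C := (C + C) * (C + C))); last first.
  by move=> x; rewrite -expr2.
have gE w : g w = average (J k.+1) (L k) (rmx X w).
  rewrite /g /g' /average; congr Ex; apply/funext => v; apply: L_loo => i j ik.
  by rewrite !mxE !inE ltnS (leq_eqVlt i) -[(i == k :> nat)]/(i == k) (negbTE ik).
have DE w : f k.+1 w - g w = average (J k.+1) D (rmx X w).
  by rewrite gE /f /average -ExB //; [exact: (intg_mix _ mF FC)|exact: (intg_mix _ (mL k) (LC k))].
apply: le_Ex.
- rewrite (_ : (fun w => _) = (fun w => average (J k.+1) D (rmx X w) ^+ 2)); last first.
    by apply/funext => w; rewrite DE.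
  apply: (@intg_mxfun ((C + C) * (C + C)) (fun x => average (J k.+1) D x ^+ 2)).
    by apply: mxfunM; exact: measurable_average DC.
  by move=> x; rewrite normrX expr2 ler_pM // average_bounded.
- apply: (@intg_mxfun ((C + C) * (C + C)) (average (J k.+1) (fun x => D x * D x))).
    by apply: measurable_average => [|x]; [exact: mxfunM|rewrite -expr2; exact: D2C].
  by move=> x; apply: average_bounded => [|y]; [exact: mxfunM|rewrite -expr2; exact: D2C].
- move=> w; rewrite DE /average.
  have ID := intg_mix (J k.+1) mD DC (rmx X w).
  have ID2 : intg P (fun w' => D (mix (J k.+1) (rmx X w) (rmx X w')) ^+ 2).
    by apply: (@intg_mix ((C + C) * (C + C)) (fun x => D x ^+ 2)) => //; exact: mxfunM.
  have := @Ex_cauchy_schwarz _ _ _ P _ (fun=> 1) (intg_meas ID) (measurable_cst _) ID2.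
  rewrite (_ : (fun w0 => _ * 1) = (fun w' => D (mix (J k.+1) (rmx X w) (rmx X w')))); last first.
    by apply/funext => v; rewrite mulr1.
  under [in X in X -> _]eq_fun do rewrite expr1n.
  by rewrite Ex_cst mulr1; apply; exact: intg_cst.
Qed.

Lemma efron_stein :
  Ex P (fun w => F (rmx X w) ^+ 2) - Ex P (fun w => F (rmx X w)) ^+ 2 <=
  \sum_k Ex P (fun w => (F (rmx X w) - L k (rmx X w)) ^+ 2).
Proof.
apply: le_trans (_ : \sum_(k < n) (Ex P (fun w => f k.+1 w ^+ 2) - Ex P (fun w => f k w ^+ 2)) <= _); last first.
  by apply: ler_sum => k _; exact: efron_stein_step.
rewrite -(big_mkord xpredT (fun k => Ex P (fun w => f k.+1 w ^+ 2) - Ex P (fun w => f k w ^+ 2))).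
rewrite telescope_sumr // le_eqVlt; apply/orP; left; apply/eqP; congr (_ - _).
  congr Ex; apply/funext => w; rewrite /f /average.
  rewrite (_ : J n = [set: 'I_n]%SET); last by apply/setP => i; rewrite !inE ltn_ord.
  by under [X in Ex _ X]eq_fun do rewrite mix_setT; rewrite Ex_cst.
transitivity (Ex P (fun=> Ex P (fun w => F (rmx X w)) ^+ 2)); first by rewrite Ex_cst.
congr Ex; apply/funext => w; rewrite /f /average.
rewrite (_ : J 0%N = finset.set0); last by apply/setP => i; rewrite !inE.
by under [X in _ = Ex _ X ^+ 2]eq_fun do rewrite mix_set0.
Qed.

End EfronStein.

(** * The statistic as a function of the data matrix *)

Section MeasurableMatrix.
Context {d : measure_display} {T : measurableType d} {R : realType}.

Definition measurable_mx (m n : nat) (f : T -> 'M[R]_(m, n)) : Prop :=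
  forall i j, measurable_fun setT (fun w => f w i j).

Lemma measurable_mx_cst m n (A : 'M[R]_(m, n)) : measurable_mx (fun=> A).
Proof. by move=> i j; exact: measurable_cst. Qed.

Lemma measurable_mxD m n (f g : T -> 'M[R]_(m, n)) : measurable_mx f -> measurable_mx g -> measurable_mx (fun w => f w + g w).
Proof.
by move=> mf mg i j; under eq_fun do rewrite mxE; exact: measurable_funD.
Qed.

Lemma measurable_mxZ m n a (f : T -> 'M[R]_(m, n)) : measurable_mx f -> measurable_mx (fun w => a *: f w).
Proof.
by move=> mf i j; under eq_fun do rewrite mxE; exact: measurable_funM.
Qed.

Lemma measurable_mxM m n q (f : T -> 'M[R]_(m, n)) (g : T -> 'M[R]_(n, q)) :
  measurable_mx f -> measurable_mx g -> measurable_mx (fun w => f w *m g w).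
Proof.
move=> mf mg i j; under eq_fun do rewrite mxE.
by apply: measurable_sum => k; exact: measurable_funM.
Qed.

Lemma measurable_mx_tr m n (f : T -> 'M[R]_(m, n)) : measurable_mx f -> measurable_mx (fun w => (f w)^T).
Proof. by move=> mf i j; under eq_fun do rewrite mxE; exact: mf. Qed.

Lemma measurable_mx_sum (I : finType) m n (F : I -> T -> 'M[R]_(m, n)) :
  (forall i, measurable_mx (F i)) -> measurable_mx (fun w => \sum_i F i w).
Proof.
move=> mF i j; under eq_fun do rewrite summxE.
by apply: measurable_sum => k; exact: mF.
Qed.

Lemma measurable_det n (f : T -> 'M[R]_n) : measurable_mx f -> measurable_fun setT (fun w => \det (f w)).
Proof.
move=> mf; apply: measurable_sum => s; apply: measurable_funM => //.
by apply: measurable_prod.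
Qed.

Lemma measurable_mx_inv n (f : T -> 'M[R]_n) : measurable_mx f -> (forall w, f w \in unitmx) ->
  measurable_mx (fun w => invmx (f w)).
Proof.
move=> mf uf i j.
rewrite (_ : (fun w => _) = (fun w => (\det (f w))^-1 * cofactor (f w) j i)).
  apply: measurable_funM; last first.
    apply: measurable_funM => //; apply: measurable_det => k l.
    by under eq_fun do rewrite !mxE; exact: mf.
  apply: measurable_inv => [|w]; first exact: measurable_det.
  by have := uf w; rewrite unitmxE unitfE.
by apply/funext => w; rewrite /invmx uf !mxE.
Qed.

End MeasurableMatrix.

Section Statistic.
Context {R : realType} (n p : nat).
Variables (r : 'I_n -> R) (A S : 'M[R]_p) (t : R) (x : 'cV[R]_p) (alpha : 'cV[R]_n).
Implicit Types (X : 'M[R]_(n, p)).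

Definition obs (i : 'I_n) X : 'cV[R]_p := (row i X)^T.
Definition rho (i : 'I_n) : R := r i ^+ 2 / n%:R.
Definition acoef (i : 'I_n) : R := alpha i 0 * r i / Num.sqrt n%:R.
Definition gram X : 'M[R]_p := A + \sum_i rho i *: (obs i X *m (obs i X)^T).
Definition score X : 'cV[R]_p := \sum_i acoef i *: obs i X.

(** Setting row [i] to zero removes its contributions to [gram] and [score]
without changing the dimensions. *)
Definition drop_row (i : 'I_n) X : 'M[R]_(n, p) := \matrix_(k, j) if k == i then 0 else X k j.

Lemma obs_drop_row i k X : obs k (drop_row i X) = if k == i then 0 else obs k X.
Proof.
apply/matrixP => j l; case: eqP => ki; rewrite !mxE; first by rewrite ki eqxx.
by case: eqP.
Qed.

Lemma gram_drop_row i X : gram X = gram (drop_row i X) + rho i *: (obs i X *m (obs i X)^T).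
Proof.
rewrite /gram (bigD1 i) //= [in RHS](bigD1 i) //= obs_drop_row eqxx mul0mx scaler0 add0r.
rewrite -addrA; congr (_ + _); rewrite addrC; congr (_ + _).
by apply: eq_bigr => k /negbTE ki; rewrite obs_drop_row ki.
Qed.

Lemma score_drop_row i X : score X = score (drop_row i X) + acoef i *: obs i X.
Proof.
rewrite /score (bigD1 i) //= [in RHS](bigD1 i) //= obs_drop_row eqxx scaler0 add0r.
rewrite addrC; congr (_ + _).
by apply: eq_bigr => k /negbTE ki; rewrite obs_drop_row ki.
Qed.

Hypotheses (pdA : pdmx A) (t0 : 0 < t) (At : loewner_ge A t%:M) (psdS : psdmx S)
  (nalpha : enorm alpha = 1).

Lemma rho_ge0 i : 0 <= rho i.
Proof. by rewrite mulr_ge0 ?sqr_ge0 // invr_ge0 ler0n. Qed.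

Lemma gram_sym X : (gram X)^T = gram X.
Proof.
rewrite /gram linearD /= pdA.1; congr (_ + _); rewrite linear_sum /=.
by apply: eq_bigr => i _; rewrite linearZ /= trmx_mul trmxK.
Qed.

Lemma qform_gram X u : qform (gram X) u = qform A u + \sum_i rho i * dotv (obs i X) u ^+ 2.
Proof.
rewrite /gram qformD qform_sum; congr (_ + _); apply: eq_bigr => i _.
by rewrite qformZ qform_outer.
Qed.

Lemma qform_A_gram X u : qform A u <= qform (gram X) u.
Proof.
rewrite qform_gram lerDl sumr_ge0 // => i _.
by rewrite mulr_ge0 ?sqr_ge0 ?rho_ge0.
Qed.

Lemma gram_ge X u : t * dotv u u <= qform (gram X) u.
Proof.
apply: le_trans (qform_A_gram X u).
by have := At.2 u; rewrite qformB subr_ge0 qform_scalar.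
Qed.

Lemma gram_pd X : pdmx (gram X).
Proof. exact: resolvent_pd (gram_sym X) t0 (gram_ge X). Qed.

Let b := b_op A S.
Let q := qform (invmx A) x.

Lemma S_le_gram X u : qform S u <= b * qform (gram X) u.
Proof.
apply: le_trans (qform_le_b_op _ pdA psdS) _.
by rewrite ler_wpM2l ?b_op_ge0 ?qform_A_gram.
Qed.

Lemma qform_inv_gram X u : qform (invmx (gram X)) u <= qform (invmx A) u.
Proof. apply: qform_inv_anti (gram_pd X) _ => // v; exact: qform_A_gram. Qed.

(** Let u = M^-1 w. The left side is w^T u, which is the inner product of [alpha]
with the vector of the (r i / sqrt n) X_i^T u. Its square is at most the sum of
the [rho i] (X_i^T u)^2, a part of u^T M u, and u^T M u is again the left
side. *)
Lemma qform_inv_score X : qform (invmx (gram X)) (score X) <= 1.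
Proof.
have Mu := pdmx_unit (gram_pd X).
apply: le_of_sqr_le => //; rewrite mul1r.
set G := invmx _; pose u := G *m score X.
pose y : 'cV[R]_n := \col_i (r i / Num.sqrt n%:R * dotv (obs i X) u).
have -> : qform G (score X) ^+ 2 = dotv alpha y ^+ 2.
  congr (_ ^+ 2); rewrite qformE -/u {1}/score dotv_suml dotvE; apply: eq_bigr => i _.
  by rewrite dotvZl mxE /acoef !mulrA.
apply: le_trans (dotv_cauchy_schwarz _ _) _.
rewrite -sqr_enorm nalpha expr1n mul1r qform_inv // ?gram_sym //.
rewrite qform_gram; apply: ler_wpDl; first exact: (pdmx_psd pdA).2.
rewrite dotvE; apply: ler_sum => i _; rewrite mxE -expr2 exprMn ler_wpM2r ?sqr_ge0 //.
by rewrite exprMn exprVn sqr_sqrtr ?ler0n.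
Qed.

Lemma HstatE X : Hstat r A S x alpha X =
  dotv (invmx (gram X) *m score X) (S *m (invmx (gram X) *m x)).
Proof.
rewrite /Hstat; set D := diag_mx _.
have -> : n%:R^-1 *: (X^T *m (D *m D) *m X) + A = gram X.
  rewrite addrC /gram; congr (_ + _); apply/matrixP => j k.
  rewrite mxE summxE -mulmxA -mulmxA mul_diag_mx mul_diag_mx !mxE mulr_sumr.
  apply: eq_bigr => i _; rewrite !mxE big_ord1 !mxE /rho; ring.
have -> : score X = (Num.sqrt n%:R)^-1 *: (alpha^T *m D *m X)^T.
  apply/matrixP => j k; rewrite !mxE summxE mulr_sumr; apply: eq_bigr => i _.
  rewrite !ord1 mul_mx_diag !mxE /acoef; ring.
rewrite -scalemxAr dotvZl; congr (_ * _).
rewrite dotv_mulmxl trmx_inv gram_sym /dotv trmxK.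
by rewrite !mulmxA.
Qed.

Lemma q_ge0 : 0 <= q.
Proof. exact: (pdmx_psd (pdmx_inv pdA)).2. Qed.

Lemma Hstat_bounded X : `|Hstat r A S x alpha X| <= b * Num.sqrt q.
Proof.
have q0 := q_ge0.
rewrite -(@ler_pXn2r _ 2) ?nnegrE ?mulr_ge0 ?sqrtr_ge0 ?b_op_ge0 //.
rewrite real_normK ?num_real // HstatE exprMn sqr_sqrtr //.
apply: le_trans (bilinear_resolvent_le (gram_sym X) t0 (gram_ge X) psdS (S_le_gram X) _ _) _.
rewrite ler_wpM2l ?sqr_ge0 // -[leRHS]mul1r; apply: ler_pM.
- exact: qform_resolvent_ge0 (gram_sym X) t0 (gram_ge X) _.
- exact: qform_resolvent_ge0 (gram_sym X) t0 (gram_ge X) _.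
- exact: qform_inv_score.
- exact: qform_inv_gram.
Qed.

End Statistic.

(** * Leaving one row out *)

Section MeasurableStatistic.
Context {R : realType} (n p : nat).
Variables (r : 'I_n -> R) (A S : 'M[R]_p) (t : R) (x : 'cV[R]_p) (alpha : 'cV[R]_n).
Hypotheses (pdA : pdmx A) (t0 : 0 < t) (At : loewner_ge A t%:M).

Lemma measurable_Hstat : measurable_mxfun (Hstat r A S x alpha).
Proof.
move=> d T f mf.
have mrow i : measurable_mx (fun w => obs i (f w)).
  apply: measurable_mx_tr => k j; under eq_fun do rewrite mxE; exact: mf.
have mM : measurable_mx (fun w => gram r A (f w)).
  apply: measurable_mxD; first exact: measurable_mx_cst.
  by apply: measurable_mx_sum => i; apply: measurable_mxZ; apply: measurable_mxM => //; exact: measurable_mx_tr.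
have mw : measurable_mx (fun w => score r alpha (f w)).
  by apply: measurable_mx_sum => i; exact: measurable_mxZ.
have mG : measurable_mx (fun w => invmx (gram r A (f w))).
  by apply: measurable_mx_inv => // w; apply: pdmx_unit; exact: gram_pd pdA t0 At _.
under eq_fun do rewrite (HstatE _ _ _ _ pdA).
apply: (measurable_mxM (measurable_mx_tr (measurable_mxM mG mw)) (measurable_mxM (measurable_mx_cst S) (measurable_mxM mG (measurable_mx_cst x)))).
Qed.

Lemma measurable_drop_row i (Phi : 'M[R]_(n, p) -> R) : measurable_mxfun Phi ->
  measurable_mxfun (fun X => Phi (drop_row i X)).
Proof.
move=> mPhi d' T' f mf; apply: mPhi => k j; under eq_fun do rewrite mxE.
by case: eqP => _; [exact: measurable_cst|exact: mf].
Qed.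

End MeasurableStatistic.

Section MomentNumbers.
Context {d : measure_display} {T : measurableType d} {R : realType}.
Variable P : probability T R.

(** The dimension is positive because a bound on all unit vectors says nothing
when there are none. *)
Lemma linear_bound_ge0 (p : nat) (Z : 'I_p.+1 -> {RV P >-> R}) k (beta : R) :
  linear_moment_bound Z k beta%:E -> 0 <= beta.
Proof.
move=> /(_ (delta_mx 0 0)) h; rewrite -lee_fin; apply: le_trans (h _).
  by rewrite unlock; apply: integral_ge0 => w _; rewrite lee_fin exprn_ge0.
rewrite /enorm dotvE (bigD1 0) //= !mxE eqxx mulr1 big1 ?addr0 ?sqrtr1 // => i i0.
by rewrite !mxE (negbTE i0) mul0r.
Qed.

Lemma quadratic_bound_ge0 (p : nat) (Z : 'I_p -> {RV P >-> R}) k (beta : R) :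
  quadratic_moment_bound Z k beta%:E -> 0 <= beta.
Proof.
move=> /(_ 0) h; rewrite -lee_fin; apply: le_trans (h _ _).
- by rewrite unlock; apply: integral_ge0 => w _; rewrite lee_fin exprn_ge0.
- by split=> [|u]; rewrite ?trmx0 // qformE mul0mx dotv0r.
- apply: opnorm_le => // u; rewrite mul0mx mul1r.
  by rewrite [enorm 0](_ : _ = 0) ?enorm_ge0 // /enorm dotv0r sqrtr0.
Qed.

End MomentNumbers.

Section LeaveOneOut.
Context {d : measure_display} {T : measurableType d} {R : realType}.
Variable P : probability T R.
Context (n p' : nat).
Let p := p'.+1.
Variables (r : 'I_n -> R) (A S : 'M[R]_p) (t : R) (x : 'cV[R]_p) (alpha : 'cV[R]_n).
Hypotheses (pdA : pdmx A) (t0 : 0 < t) (At : loewner_ge A t%:M) (psdS : psdmx S)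
  (nalpha : enorm alpha = 1) (r0 : forall i, 0 < r i).
Let b := b_op A S.
Let q := qform (invmx A) x.
Let H := Hstat r A S x alpha.

Section Row.
Variables (i : 'I_n) (B : 'M[R]_(n, p)).
Let M := gram r A (drop_row i B).
Let G := invmx M.
Let w := score r alpha (drop_row i B).
Let v1 := G *m S *m G *m x.
Let v2 := G *m x.
Let v3 := G *m S *m G *m w.
Let v4 := G *m w.
Let a := acoef r alpha i.
Let rhoi := rho r i.
Let sM : M^T = M := gram_sym r pdA _.
Let Mt := gram_ge r At (drop_row i B).
Let SM := S_le_gram r pdA psdS (drop_row i B).

Lemma Hstat_row (Z : 'I_p -> {RV P >-> R}) o :
  obs i B = rvec Z o ->
  H B - H (drop_row i B) = increment Z v1 v2 v3 v4 a rhoi G (G *m S *m G) o.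
Proof.
move=> rowB; rewrite /H !(HstatE _ _ _ _ pdA) (gram_drop_row r A i B) (score_drop_row r alpha i B).
rewrite (rank_one_update _ (gram_pd r pdA t0 At _) psdS.1 (rho_ge0 r i)) rowB.
by rewrite /increment /coef_c /coef_c2h /zdot -!mulrA.
Qed.

Let nv1 : dotv v1 v1 <= b ^+ 2 * (q / t).
Proof.
apply: le_trans (norm_sandwich sM t0 Mt psdS SM x) _; rewrite mulrA.
rewrite ler_wpM2r ?invr_ge0 ?(ltW t0) // ler_wpM2l ?sqr_ge0 //.
exact: qform_inv_gram pdA t0 At _ _.
Qed.

Let nv2 : dotv v2 v2 <= q / t.
Proof.
apply: le_trans (norm_resolvent sM t0 Mt x) _.
rewrite ler_wpM2r ?invr_ge0 ?(ltW t0) //; exact: qform_inv_gram pdA t0 At _ _.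
Qed.

Let nv3 : dotv v3 v3 <= b ^+ 2 / t.
Proof.
apply: le_trans (norm_sandwich sM t0 Mt psdS SM w) _.
rewrite ler_wpM2r ?invr_ge0 ?(ltW t0) // -[leRHS]mulr1 ler_wpM2l ?sqr_ge0 //.
exact: qform_inv_score pdA t0 At nalpha _.
Qed.

Let nv4 : dotv v4 v4 <= t^-1.
Proof.
apply: le_trans (norm_resolvent sM t0 Mt w) _.
rewrite -[leRHS]mul1r ler_wpM2r ?invr_ge0 ?(ltW t0) //; exact: qform_inv_score pdA t0 At nalpha _.
Qed.

Variables (Z : 'I_p -> {RV P >-> R}) (Sigma : 'M[R]_p) (bL bQ : nat -> \bar R).
Hypotheses (covZ : centered_with_cov Z Sigma) (momZ : moment_numbers Z bL bQ).
Let beta2 := fine (bL 2%N).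
Let beta4 := fine (bL 4%N).
Let betaQ := fine (bQ 2%N).

Let lin2 : linear_moment_bound Z 2 beta2%:E.
Proof. by case: momZ => lin _ _ [? ? ?]; rewrite /beta2 fineK //; exact: lin. Qed.
Let lin4 : linear_moment_bound Z 4 beta4%:E.
Proof. by case: momZ => lin _ _ [? ? ?]; rewrite /beta4 fineK //; exact: lin. Qed.
Let quad2 : quadratic_moment_bound Z 2 betaQ%:E.
Proof. by case: momZ => _ quad _ [? ? ?]; rewrite /betaQ fineK //; exact: quad. Qed.
Let beta2_ge0 := linear_bound_ge0 lin2.
Let beta4_ge0 := linear_bound_ge0 lin4.
Let betaQ_ge0 := quadratic_bound_ge0 quad2.

Let kappa_ge0 : 0 <= q / t.
Proof. by rewrite divr_ge0 ?(ltW t0) //; exact: q_ge0. Qed.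

Let G_ge0 z : 0 <= qform G z. Proof. exact: qform_resolvent_ge0 sM t0 Mt z. Qed.
Let N_ge0 z : 0 <= qform (G *m S *m G) z. Proof. exact: (sandwich_psd sM psdS).2. Qed.
Let NG z : qform (G *m S *m G) z <= b * qform G z.
Proof. exact: qform_sandwich sM t0 Mt SM z. Qed.

Let W := a ^+ 2 * beta2 + rhoi ^+ 2 * (beta4 / t).

Let a2E : a ^+ 2 = r i ^+ 2 / n%:R * alpha i 0 ^+ 2.
Proof. by rewrite /a /acoef !exprMn exprVn sqr_sqrtr ?ler0n //; ring. Qed.

Lemma row_second_moment :
  Ex P (fun o => increment Z v1 v2 v3 v4 a rhoi G (G *m S *m G) o ^+ 2) <=
  16 * b ^+ 2 * (q / t) *
    (r i ^+ 2 / n%:R * alpha i 0 ^+ 2 * fine (bL 2%N)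
     + r i ^+ 4 / n%:R ^+ 2 * fine (bL 4%N) * (1 / t)).
Proof.
have rh0 : 0 <= rhoi := rho_ge0 r i.
apply: le_trans (increment_moment2 lin2 lin4 beta2_ge0 beta4_ge0 a (b_op_ge0 A S) kappa_ge0 t0
  rh0 nv1 nv2 nv3 nv4 G_ge0 N_ge0 NG).2 _.
rewrite a2E /rhoi /rho le_eqVlt; apply/orP; left; apply/eqP; rewrite -/beta2 -/beta4 -/b -exprVn. ring.
Qed.

Definition row_mean := increment_center Sigma v1 v2 v3 v4 rhoi G (G *m S *m G).

(** The value [row_mean] involves the random vector through Sigma only, so it is
common to the old and to the new row in an exchange. *)
Lemma row_mean_dist :
  intg P (increment Z v1 v2 v3 v4 a rhoi G (G *m S *m G)) /\
  `|Ex P (increment Z v1 v2 v3 v4 a rhoi G (G *m S *m G)) - row_mean| <=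
  16 * b * Num.sqrt (q / t) *
    (1 / Num.sqrt n%:R * `|alpha i 0| * r i * Num.sqrt (fine (bL 2%N))
     + r i ^+ 2 / n%:R * Num.sqrt (fine (bL 4%N) / t)) *
    Num.min (r i ^+ 2 / n%:R * (Num.sqrt (fine (bQ 2%N)) / t)) 1.
Proof.
have rh0 : 0 <= rhoi := rho_ge0 r i.
have b0 : 0 <= b := b_op_ge0 A S.
pose gamma := Num.sqrt betaQ / t.
have gamma0 : 0 <= gamma by rewrite divr_ge0 ?sqrtr_ge0 ?ltW.
have gamma2 : gamma ^+ 2 = t^-1 ^+ 2 * betaQ by rewrite exprMn sqr_sqrtr // mulrC.
have varG : intg P (fun o => (qform G (rvec Z o) - pairing Sigma G) ^+ 2) /\
    Ex P (fun o => (qform G (rvec Z o) - pairing Sigma G) ^+ 2) <= gamma ^+ 2.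
  rewrite gamma2; apply: (quadratic_moment lin2 covZ quad2); rewrite ?invr_gt0 // invrK.
    exact: resolvent_psd sM t0 Mt.
  exact: opnorm_resolvent sM t0 Mt.
have varN : intg P (fun o => (qform (G *m S *m G) (rvec Z o) - pairing Sigma (G *m S *m G)) ^+ 2) /\
    Ex P (fun o => (qform (G *m S *m G) (rvec Z o) - pairing Sigma (G *m S *m G)) ^+ 2)
    <= b ^+ 2 * gamma ^+ 2.
  have [b00|bn0] := eqVneq b 0.
    have q0 o : qform (G *m S *m G) (rvec Z o) = 0.
      by apply/eqP; rewrite eq_le N_ge0 andbT; have := NG (rvec Z o); rewrite b00 mul0r.
    rewrite -(Ex_qform lin2 covZ).
    have -> : (fun o => qform (G *m S *m G) (rvec Z o)) = (fun=> 0).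
      by apply/funext => o; exact: q0.
    rewrite Ex_cst; under eq_fun do rewrite q0 subr0 expr0n.
    by rewrite Ex_cst; split; [exact: intg_cst|rewrite mulr_ge0 ?sqr_ge0].
  have bgt0 : 0 < b by rewrite lt_neqAle eq_sym bn0.
  rewrite gamma2 mulrA -exprMn; apply: (quadratic_moment lin2 covZ quad2).
  - by rewrite divr_gt0.
  - rewrite invfM invrK mulrC; exact: sandwich_scaled_psd sM t0 psdS b0.
  - rewrite invfM invrK mulrC; exact: opnorm_sandwich sM t0 Mt psdS SM bgt0.
have [ID ED] := increment_mean lin2 lin4 beta2_ge0 beta4_ge0 covZ a b0 kappa_ge0 t0
  rh0 nv1 nv2 nv3 nv4 G_ge0 N_ge0 NG gamma0 varG varN.
split=> //; apply: le_trans ED _.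
rewrite -/W; set m := Num.min _ _.
have m0 : 0 <= m by rewrite le_min ler01 andbT mulr_ge0.
set W' := (X in _ <= _ * X * m).
have W'0 : 0 <= W'.
  by rewrite addr_ge0 // !mulr_ge0 ?sqrtr_ge0 ?invr_ge0 ?ler0n ?sqrtr_ge0 ?(ltW (r0 i)).
have sW : Num.sqrt W <= W'.
  rewrite -[leRHS]ger0_norm // -sqrtr_sqr ler_sqrt ?sqr_ge0 //.
  have y0 : 0 <= beta4 / t by rewrite divr_ge0 // ltW.
  have -> : W = (1 / Num.sqrt n%:R * `|alpha i 0| * r i * Num.sqrt beta2) ^+ 2 +
     (r i ^+ 2 / n%:R * Num.sqrt (beta4 / t)) ^+ 2.
    rewrite /W a2E !exprMn !sqr_sqrtr // !exprVn expr1n mul1r sqr_sqrtr ?ler0n //.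
    by rewrite real_normK ?num_real //; ring.
  have sq (y z : R) : 0 <= y -> 0 <= z -> y ^+ 2 + z ^+ 2 <= (y + z) ^+ 2 by nra.
  by apply: sq; rewrite !mulr_ge0 ?sqrtr_ge0 ?invr_ge0 ?ler0n ?sqrtr_ge0 ?(ltW (r0 i)).
have K0 : 0 <= b * Num.sqrt (q / t) by rewrite mulr_ge0 ?sqrtr_ge0.
have : b * Num.sqrt (q / t) * Num.sqrt W * m <= b * Num.sqrt (q / t) * W' * m.
  by rewrite ler_wpM2r // ler_wpM2l.
have : 0 <= b * Num.sqrt (q / t) * W' * m by rewrite !mulr_ge0 // sqrtr_ge0.
rewrite -!(mulrA 16); set u := _ * W' * m; set u' := _ * m => u0 u'u.
lra.
Qed.

End Row.
End LeaveOneOut.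

(** * The exchange of rows and the main bounds *)

Section Hybrid.
Context {d : measure_display} {T : measurableType d} {R : realType}.
Variable P : probability T R.
Context (n p : nat).
Variables (X Y : 'I_n -> 'I_p -> {RV P >-> R}).

(** The successive families of the exchange, from Y at k = 0 to X at k = n. *)
Definition hybrid (k : nat) (i : 'I_n) : 'I_p -> {RV P >-> R} :=
  if (i < k)%N then X i else Y i.

Lemma rect_sigma_family (Z : 'I_n -> 'I_p -> {RV P >-> R}) (J : {set 'I_n}) (E : 'I_n -> set T) :
  (forall i, i \in J -> sigma_vec (Z i) (E i)) ->
  sigma_family Z (\bigcap_(i in [set` J]) E i).
Proof.
move=> sE; apply: (@fin_bigcap_measurable _ (g_sigma_algebraType
  (\bigcup_(i in [set: 'I_n]) sigma_vec (Z i)))) => // i iJ.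
by apply: sub_sigma_algebra; exists i => //; exact: sE.
Qed.

(** The rows taken from X and those taken from Y are separated by the independence
of the two families, and each group obeys its own product rule. *)
Lemma hybrid_independent (k : nat) : mutually_independent X -> mutually_independent Y ->
  independent_families X Y -> mutually_independent (hybrid k).
Proof.
move=> iX iY iXY J E sE.
pose J1 := [set i in J | (i < k)%N]%SET; pose J2 := [set i in J | ~~ (i < k)%N]%SET.
have sX i : i \in J1 -> sigma_vec (X i) (E i).
  by rewrite inE => /andP[iJ ik]; have := sE i iJ; rewrite /hybrid ik.
have sY i : i \in J2 -> sigma_vec (Y i) (E i).
  by rewrite inE => /andP[iJ ik]; have := sE i iJ; rewrite /hybrid (negbTE ik).
have -> : \bigcap_(i in [set` J]) E i =
    (\bigcap_(i in [set` J1]) E i) `&` (\bigcap_(i in [set` J2]) E i).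
  apply/seteqP; split=> w.
    by move=> wE; split=> i /=; rewrite inE => /andP[iJ _]; exact: wE.
  move=> [w1 w2] i /= iJ; have [ik|ik] := boolP (i < k)%N.
    by apply: w1; rewrite /= inE iJ.
  by apply: w2; rewrite /= inE iJ.
rewrite iXY; [|exact: rect_sigma_family|exact: rect_sigma_family].
rewrite iX // iY // [RHS](bigID (fun i : 'I_n => (i < k)%N)) /=.
by congr (_ * _)%E; apply: eq_bigl => i; rewrite inE.
Qed.

End Hybrid.

Section Variance.
Context {d : measure_display} {T : measurableType d} {R : realType}.
Variable P : probability T R.

Lemma variance_bounded (f : T -> R) (C : R) : measurable_fun setT f ->
  (forall w, `|f w| <= C) -> 'V_P[f] = (Ex P (fun w => f w ^+ 2) - Ex P f ^+ 2)%:E.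
Proof.
move=> mf fC; have If := intg_bounded P mf fC.
have Iff : intg P (fun w => f w ^+ 2).
  apply: (@intg_bounded _ _ _ _ _ (C * C)) => [|w]; first exact: measurable_funX.
  by rewrite normrX expr2 ler_pM.
have I2 := intgZ (2 * Ex P f) If.
have I3 := intgB Iff I2.
have IV : intg P (fun w => (f w ^+ 2 - 2 * Ex P f * f w) + Ex P f ^+ 2).
  by apply: intgD => //; exact: intg_cst.
rewrite /variance covariance.unlock expectation.unlock -/(Ex P f).
transitivity (\int[P]_w ((f w ^+ 2 - 2 * Ex P f * f w) + Ex P f ^+ 2)%:E)%E.
  apply: eq_integral => w _; congr EFin.
  transitivity ((f w - Ex P f) * (f w - Ex P f)) => //; ring.
rewrite (ExE IV) ExD //; last exact: intg_cst.
by rewrite ExB // ExZ // Ex_cst; congr EFin; ring.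
Qed.

End Variance.

Section Main.
Context {d : measure_display} {T : measurableType d} {R : realType}.
Variable P : probability T R.
Context (n p' : nat).
Let p := p'.+1.
Variables (r : 'I_n -> R) (A S : 'M[R]_p) (t : R) (x : 'cV[R]_p) (alpha : 'cV[R]_n).
Hypotheses (pdA : pdmx A) (t0 : 0 < t) (At : loewner_ge A t%:M) (psdS : psdmx S)
  (nalpha : enorm alpha = 1) (r0 : forall i, 0 < r i).
Let b := b_op A S.
Let q := qform (invmx A) x.
Let H := Hstat r A S x alpha.
Let C := b * Num.sqrt q.
Let mH : measurable_mxfun H := measurable_Hstat r S x alpha pdA t0 At.
Let HC X : `|H X| <= C := Hstat_bounded r x pdA t0 At psdS nalpha X.
Let L i X := H (drop_row i X).
Let mL i : measurable_mxfun (L i) := measurable_drop_row i mH.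
Let D i X := H X - L i X.
Let mD i : measurable_mxfun (D i) := mxfunB mH (mL i).
Let DC i X : `|D i X| <= C + C.
Proof. by apply: le_trans (ler_normB _ _) _; apply: lerD; exact: HC. Qed.

Lemma drop_row_mix i (B B' : 'M[R]_(n, p)) : drop_row i (mix (~: [set i])%SET B B') = drop_row i B.
Proof.
apply/matrixP => k j; rewrite !mxE; case: eqP => // /eqP ki.
by rewrite !inE ki.
Qed.

Lemma obs_mix i (B : 'M[R]_(n, p)) (Z : 'I_n -> 'I_p -> {RV P >-> R}) w :
  obs i (mix (~: [set i])%SET B (rmx Z w)) = rvec (Z i) w.
Proof. by apply/matrixP => j k; rewrite !mxE !inE eqxx. Qed.

Let dterm i B (Z : 'I_p -> {RV P >-> R}) w :=
  let G := invmx (gram r A (drop_row i B)) in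
  let v := score r alpha (drop_row i B) in
  increment Z (G *m S *m G *m x) (G *m x) (G *m S *m G *m v) (G *m v)
    (acoef r alpha i) (rho r i) G (G *m S *m G) w.

Let D_mix i B (Z : 'I_n -> 'I_p -> {RV P >-> R}) w :
  D i (mix (~: [set i])%SET B (rmx Z w)) = dterm i B (Z i) w.
Proof.
rewrite /D /L /H (Hstat_row r x alpha pdA t0 At psdS (obs_mix i B Z w)).
by rewrite drop_row_mix.
Qed.

Definition variance_term (bL : nat -> \bar R) (i : 'I_n) : R :=
  16 * b ^+ 2 * (q / t) *
    (r i ^+ 2 / n%:R * alpha i 0 ^+ 2 * fine (bL 2%N)
     + r i ^+ 4 / n%:R ^+ 2 * fine (bL 4%N) * (1 / t)).

Definition mean_term (bL bQ : nat -> \bar R) (i : 'I_n) : R :=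
  16 * b * Num.sqrt (q / t) *
    (1 / Num.sqrt n%:R * `|alpha i 0| * r i * Num.sqrt (fine (bL 2%N))
     + r i ^+ 2 / n%:R * Num.sqrt (fine (bL 4%N) / t)) *
    Num.min (r i ^+ 2 / n%:R * (Num.sqrt (fine (bQ 2%N)) / t)) 1.

Lemma Hstat_variance (X : 'I_n -> 'I_p -> {RV P >-> R}) (bL bQ : 'I_n -> nat -> \bar R) :
  mutually_independent X -> (forall i, moment_numbers (X i) (bL i) (bQ i)) ->
  ('V_P[fun w => H (rmx X w)] <= (\sum_i variance_term (bL i) i)%:E)%E.
Proof.
move=> indX momX.
have mHX : measurable_fun setT (fun w => H (rmx X w)).
  exact: intg_meas (intg_mxfun X mH HC).
rewrite (variance_bounded P (C := C) mHX) // lee_fin.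
apply: le_trans (efron_stein indX mH HC mL (fun i X' => HC (drop_row i X')) _) _.
  move=> k B B' BB'; congr H; apply/matrixP => i j; rewrite !mxE.
  by case: eqP => // /eqP ik; exact: BB'.
apply: ler_sum => i _.
have D2C B : `|D i B * D i B| <= (C + C) * (C + C) by rewrite normrM ler_pM.
have mDD := mxfunM (mD i) (mD i).
rewrite (_ : Ex P _ = Ex P (fun w => D i (rmx X w) * D i (rmx X w))); last first.
  by congr Ex; apply/funext => w; rewrite -expr2.
rewrite (decouple indX (~: [set i])%SET mDD D2C) -[leRHS](Ex_cst P).
apply: le_Ex => [||w]; [|exact: intg_cst|].
  apply: (intg_mxfun X (Phi := average X (~: [set i])%SET (fun B => D i B * D i B))).
    exact: measurable_average D2C.
  exact: average_bounded D2C.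
rewrite (_ : Ex P _ = Ex P (fun o => dterm i (rmx X w) (X i) o ^+ 2)); last first.
  by congr Ex; apply/funext => o; rewrite D_mix -expr2.
exact: (row_second_moment r x pdA t0 At psdS nalpha i (rmx X w) (momX i)).
Qed.

(** The statistic without row [i] is the same for both families. What remains are
the increments of row [i]; after decoupling row [i] from the others, the two
conditional expectations are close to the same [row_mean], which cancels. *)
Lemma swap_one (X Y : 'I_n -> 'I_p -> {RV P >-> R}) (Sigma : 'M[R]_p)
    (bX bXQ bY bYQ : nat -> \bar R) (i : 'I_n) :
  mutually_independent X -> mutually_independent Y ->
  (forall k, k != i -> X k = Y k) ->
  centered_with_cov (X i) Sigma -> centered_with_cov (Y i) Sigma ->
  moment_numbers (X i) bX bXQ -> moment_numbers (Y i) bY bYQ ->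
  `|Ex P (fun w => H (rmx X w)) - Ex P (fun w => H (rmx Y w))| <=
  mean_term bX bXQ i + mean_term bY bYQ i.
Proof.
move=> indX indY XY covX covY momX momY.
have dropXY w : drop_row i (rmx X w) = drop_row i (rmx Y w).
  by apply/matrixP => k j; rewrite !mxE; case: eqP => // /eqP /XY ->.
have split_mean (Z : 'I_n -> 'I_p -> {RV P >-> R}) : Ex P (fun w => H (rmx Z w)) =
    Ex P (fun w => L i (rmx Z w)) + Ex P (fun w => D i (rmx Z w)).
  rewrite -ExD; [|exact: (intg_mxfun Z (mL i) (fun B => HC (drop_row i B)))|exact: (intg_mxfun Z (mD i) (DC i))].
  by congr Ex; apply/funext => w; rewrite /D addrC subrK.
have LXY : Ex P (fun w => L i (rmx X w)) = Ex P (fun w => L i (rmx Y w)).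
  by congr Ex; apply/funext => w; rewrite /L dropXY.
rewrite (split_mean X) (split_mean Y) LXY.
rewrite (_ : forall u v m : R, (m + u) - (m + v) = u - v); last by move=> *; ring.
pose eX w := average X (~: [set i])%SET (D i) (rmx X w).
pose eY w := average Y (~: [set i])%SET (D i) (rmx Y w).
have Ie (Z : 'I_n -> 'I_p -> {RV P >-> R}) : intg P (fun w => average Z (~: [set i])%SET (D i) (rmx Z w)).
  apply: (intg_mxfun Z); first exact: measurable_average (DC i).
  exact: average_bounded (DC i).
have IX : intg P eX := Ie X; have IY : intg P eY := Ie Y.
have EX : Ex P (fun w => D i (rmx X w)) = Ex P eX := decouple indX _ (mD i) (DC i).
have EY : Ex P (fun w => D i (rmx Y w)) = Ex P eY := decouple indY _ (mD i) (DC i).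
rewrite EX EY -(ExB IX IY); apply: le_trans (le_norm_Ex (intgB IX IY)) _.
rewrite -[leRHS](Ex_cst P); apply: le_Ex => [||w]; [exact: intg_norm (intgB IX IY)|exact: intg_cst|].
have eE (Z : 'I_n -> 'I_p -> {RV P >-> R}) B : average Z (~: [set i])%SET (D i) B = Ex P (dterm i B (Z i)).
  by congr Ex; apply/funext => o; rewrite D_mix.
rewrite /eX /eY !eE.
have [_ dX] := row_mean_dist x pdA t0 At psdS nalpha r0 i (rmx X w) covX momX.
have [_ dY] := row_mean_dist x pdA t0 At psdS nalpha r0 i (rmx Y w) covY momY.
move: dX; rewrite /dterm /row_mean dropXY => dX.
move: dY; rewrite /row_mean => dY.
rewrite distrC in dY.
set m := increment_center _ _ _ _ _ _ _ _ in dX dY.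
by apply: le_trans (ler_distD m _ _) _; exact: lerD dX dY.
Qed.

Lemma Hstat_mean (X Y : 'I_n -> 'I_p -> {RV P >-> R}) (Sigma : 'I_n -> 'M[R]_p)
    (bX bXQ bY bYQ : 'I_n -> nat -> \bar R) :
  mutually_independent X -> mutually_independent Y -> independent_families X Y ->
  (forall i, centered_with_cov (X i) (Sigma i)) ->
  (forall i, centered_with_cov (Y i) (Sigma i)) ->
  (forall i, moment_numbers (X i) (bX i) (bXQ i)) ->
  (forall i, moment_numbers (Y i) (bY i) (bYQ i)) ->
  (`|'E_P[fun w => (H (rmx X w) - H (rmx Y w))%R]| <=
   (\sum_i (mean_term (bX i) (bXQ i) i + mean_term (bY i) (bYQ i) i))%:E)%E.
Proof.
move=> indX indY indXY covX covY momX momY.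
have IX := intg_mxfun X mH HC; have IY := intg_mxfun Y mH HC.
rewrite expectation.unlock (ExE (intgB IX IY)) lee_fin ExB //.
pose e k := Ex P (fun w => H (rmx (hybrid X Y k) w)).
have -> : Ex P (fun w => H (rmx X w)) = e n.
  congr Ex; apply/funext => w; congr H; apply/matrixP => i j.
  by rewrite !mxE /hybrid ltn_ord.
have -> : Ex P (fun w => H (rmx Y w)) = e 0%N by [].
rewrite -telescope_sumr // big_mkord; apply: le_trans (ler_norm_sum _ _ _) _.
apply: ler_sum => i _.
have ind k : mutually_independent (hybrid X Y k) by exact: hybrid_independent.
have hX : hybrid X Y i.+1 i = X i by rewrite /hybrid ltnSn.
have hY : hybrid X Y i i = Y i by rewrite /hybrid ltnn.
apply: (swap_one (ind i.+1) (ind i)); rewrite ?hX ?hY //.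
move=> k ki; rewrite /hybrid ltnS leq_eqVlt -[(k == i :> nat)]/(k == i).
by rewrite (negbTE ki).
Qed.

End Main.

Theorem theorem3p9 (R : realType) :
  exists K : R, forall (c C : R) (n p : nat)
    (d : measure_display) (T : measurableType d) (P : probability T R)
    (X Y : 'I_n -> 'I_p -> {RV P >-> R})
    (Sigma : 'I_n -> 'M[R]_p)
    (bLX bQX bLY bQY : 'I_n -> nat -> \bar R)
    (r : 'I_n -> R) (A Seps : 'M[R]_p) (t : R)
    (x : 'cV[R]_p) (alpha : 'cV[R]_n),
  0 < c -> c <= p%:R / n%:R <= C ->
  mutually_independent X -> mutually_independent Y ->
  independent_families X Y ->
  (forall i, centered_with_cov (X i) (Sigma i)) ->
  (forall i, centered_with_cov (Y i) (Sigma i)) ->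
  (forall i, moment_numbers (X i) (bLX i) (bQX i)) ->
  (forall i, moment_numbers (Y i) (bLY i) (bQY i)) ->
  (forall i, 0 < r i) ->
  pdmx A -> 0 < t -> loewner_ge A (t%:M) ->
  psdmx Seps ->
  enorm alpha = 1 ->
  let H (Z : 'I_n -> 'I_p -> {RV P >-> R}) (w : T) : R :=
    Hstat r A Seps x alpha (rmx Z w) in
  let b := b_op A Seps in
  let q := qform (invmx A) x in
  let Vbound (bL : nat -> \bar R) (i : 'I_n) : R :=
    K * b ^+ 2 * (q / t) *
    (r i ^+ 2 / n%:R * alpha i 0 ^+ 2 * fine (bL 2%N)
     + r i ^+ 4 / n%:R ^+ 2 * fine (bL 4%N) * (1 / t)) in
  let Ubound (bL bQ2 : nat -> \bar R) (i : 'I_n) : R :=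
    K * b * Num.sqrt (q / t) *
    (1 / Num.sqrt n%:R * `|alpha i 0| * r i * Num.sqrt (fine (bL 2%N))
     + r i ^+ 2 / n%:R * Num.sqrt (fine (bL 4%N) / t)) *
    Num.min (r i ^+ 2 / n%:R * (Num.sqrt (fine (bQ2 2%N)) / t)) 1 in
  (exists V : 'I_n -> R,
     ('V_P[H X] <= (\sum_(i < n) V i)%:E)%E /\
     forall i, V i <= Vbound (bLX i) i) /\
  (exists UX UY : 'I_n -> R,
     [/\ (`|'E_P[fun w => (H X w - H Y w)%R]|
          <= (\sum_(i < n) (UX i + UY i))%:E)%E,
         forall i, UX i <= Ubound (bLX i) (bQX i) i
       & forall i, UY i <= Ubound (bLY i) (bQY i) i]).
Proof.
exists 16 => c C n p d T P X Y Sigma bLX bQX bLY bQY r A S t x alpha c0 pn.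
move=> indX indY indXY covX covY momX momY r0 pdA t0 At psdS nalpha H b q Vb Ub.
(* the lower bound on p / n excludes p = 0 *)
case: p => [|p] in X Y Sigma A S x pn indX indY indXY covX covY momX momY pdA At psdS H b q Vb Ub *.
  by move: pn; rewrite mul0r => /andP[/(lt_le_trans c0)]; rewrite ltxx.
split.
  exists (fun i => Vb (bLX i) i); split=> //.
  exact: (Hstat_variance r x pdA t0 At psdS nalpha indX momX).
exists (fun i => Ub (bLX i) (bQX i) i), (fun i => Ub (bLY i) (bQY i) i); split=> //.
exact: (Hstat_mean x pdA t0 At psdS nalpha r0 indX indY indXY covX covY momX momY).
Qed.
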